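(* Let $E,E'$ be real Banach spaces of dimension at least $2$, and let $G\subsetneq E$ and $G'\subsetneq E'$ be domains. Suppose that $f:G\to G'$ is $(M,C)$-CQH, and that $f$ extends to a homeomorphism $f:\overline{G}\to\overline{G'}$ which is $\eta$-quasimöbius relative to $\partial G$. If $G$ is diameter $c$-uniform and $G'$ is $\psi$-natural, then both $G$ and $G'$ are $c_1$-uniform with $c_1=c_1(c,M,C,\eta,\psi)\ge1$ depending only on $c,M,C,\eta,\psi$.
   Context: A domain is a nonempty connected open set; norms are written $|\cdot|$. For a set $A$ in a Banach space, $\overline{A}$ denotes its completion (that is, its norm closure) and $\partial A=\overline{A}\setminus A$ its norm boundary. For $x\in G$, $d_G(x)=\operatorname{dist}(x,\partial G)$. For an arc $\gamma$ and $x,z\in\gamma$, $\gamma[x,z]$ is the subarc between $x$ and $z$, and $\ell(\gamma)$ is the norm length; $\operatorname{diam}$ is the norm diameter. Relative quasimöbius maps: for a metric space $X$ write $\dot X=X\cup\{\infty\}$. The cross ratio of four distinct points is $\tau(x,y,z,w)=\frac{|x-z|}{|x-y|}\cdot\frac{|y-w|}{|z-w|}$, where $|a-b|$ denotes distance; if one of the points is $\infty$, the two distances involving it are cancelled, e.g. $\tau(x,y,z,\infty)=\frac{|x-z|}{|x-y|}$. Let $\eta:[0,\infty)\to[0,\infty)$ be a homeomorphism, $X,Y$ metric spaces, and $A\subseteq X_0\subseteq\dot X$. An embedding $f:X_0\to\dot Y$ is $\eta$-quasimöbius relative to $A$ if $\tau(f(x),f(y),f(z),f(w))\le\eta(\tau(x,y,z,w))$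 for every quadruple of distinct points $x,y,z,w\in X_0$ with $\{x,w\}\subseteq A$ or $\{y,z\}\subseteq A$. In the claim this is applied with $X_0=\overline G$ and $A=\partial G$. Quasihyperbolic metric: $k_G(x,y)=\inf\int_\alpha\frac{|dz|}{d_G(z)}$, the infimum over all rectifiable curves $\alpha$ in $G$ joining $x$ and $y$. Put $r_G(x,y)=\frac{|x-y|}{\min\{d_G(x),d_G(y)\}}$ and, for nonempty $A\subseteq G$, $r_G(A)=\sup_{x,y\in A}r_G(x,y)$, $k_G(A)=\sup_{x,y\in A}k_G(x,y)$. $(M,C)$-CQH ($M\ge1$, $C\ge0$): a homeomorphism $f:G\to G'$ with $\frac{k_G(x,y)-C}{M}\le k_{G'}(f(x),f(y))\le Mk_G(x,y)+C$ for all $x,y\in G$. $\psi$-natural: for an increasing function $\psi:[0,\infty)\to[0,\infty)$, $G$ is $\psi$-natural if $k_G(A)\le\psi(r_G(A))$ for every nonempty connected $A\subseteq G$ with $r_G(A)<\infty$. $c$-uniform ($c\ge1$): each pair of points $x,y\in G$ can be connected by an arc $\gamma$ in $G$ with $\ell(\gamma)\le c|x-y|$ and $\min\{\ell(\gamma[x,z]),\ell(\gamma[z,y])\}\le c\,d_G(z)$ for all $z\in\gamma$. Diameter $c$-uniform ($c\ge1$): each pair of points $x_1,x_2\in G$ can be joined by an arc $\alpha$ in $G$ with $\operatorname{diam}\alpha\le c|x_1-x_2|$ and $\min_{j=1,2}\operatorname{diam}(\alpha[x_j,x])\le c\,d_G(x)$ for all $x\in\alpha$. (The same definitions are used for $G'$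 in $E'$.) *)

(* Defs.v *)
From HB Require Import structures.
From mathcomp Require Import all_boot all_order all_algebra.
From mathcomp Require Import all_classical all_reals all_analysis.
Set Implicit Arguments.
Unset Strict Implicit.
Unset Printing Implicit Defensive.
Import Order.TTheory GRing.Theory Num.Theory.
Import numFieldNormedType.Exports.
Local Open Scope classical_set_scope.
Local Open Scope ring_scope.

Definition homeomorphism_on (X Y : topologicalType) (A : set X) (B : set Y)
    (f : X -> Y) : Prop :=
  [/\ f @` A `<=` B, {within A, continuous f} &
      exists g : Y -> X,
        [/\ g @` B `<=` A, {within B, continuous g},
            {in A, cancel f g} & {in B, cancel g f}] ].

(* The maps [0, oo) -> [0, oo) below are represented by functions R -> R; their
   values at negative arguments are irrelevant. *)
Definition increasing_gauge (R : realType) (psi : R -> R) : Prop :=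
  (forall t, 0 <= t -> 0 <= psi t) /\
  (forall s t, 0 <= s -> s <= t -> psi s <= psi t).

Section BanachSpace.
Context {R : realType} {E : completeNormedModType R}.
Implicit Types (G A : set E) (x y z w : E) (gamma : R -> E).

Definition dim_ge2 : Prop :=
  exists u v : E, forall a b : R, a *: u + b *: v = 0 -> a = 0 /\ b = 0.

Definition domain G : Prop := [/\ G !=set0, connected G & open G].

Definition bdry A : set E := closure A `\` A.

(* The infimum is a genuine one as soon as bdry G is nonempty, which holds for
   every domain G other than the whole space. *)
Definition dist_bdry G x : R := inf [set `|x - z| | z in bdry G].

Definition diam A : \bar R :=
  ereal_sup [set e | exists x y, [/\ A x, A y & e = (`|x - y|)%:E] ].

(* The length of the restriction of gamma to [a, b]. *)
Definition curve_length gamma (a b : R) : \bar R :=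
  ereal_sup
    [set (\sum_(i < size s)
            `|gamma (nth b (a :: s) i.+1) - gamma (nth b (a :: s) i)|)%:E
    | s in [set s : seq R | itv_partition a b s] ].

Definition rectifiable_curve G x y gamma : Prop :=
  [/\ {within `[0, 1], continuous gamma}, gamma @` `[0, 1] `<=` G,
      gamma 0 = x, gamma 1 = y & (curve_length gamma 0%R 1%R < +oo)%E].

(* The point of the curve gamma, defined on [0, 1], that is reached after arc
   length s. It does not depend on the choice made by xget, because gamma is
   constant on every interval on which its length function is. *)
Definition arc_length_param gamma (s : R) : E :=
  gamma (xget 0 [set t | 0 <= t <= 1 /\ curve_length gamma 0 t = s%:E]).

(* The integral of rho |dz| along the rectifiable curve gamma. *)
Definition line_integral (rho : E -> R) gamma : \bar R :=
  (\int[lebesgue_measure]_(s in `[0%R, fine (curve_length gamma 0%R 1%R)])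
     (rho (arc_length_param gamma s))%:E)%E.

Definition qh_dist G x y : \bar R :=
  ereal_inf [set line_integral (fun z => (dist_bdry G z)^-1) gamma
            | gamma in rectifiable_curve G x y].

Definition rel_dist G x y : R :=
  `|x - y| / Num.min (dist_bdry G x) (dist_bdry G y).

Definition qh_size G A : \bar R :=
  ereal_sup [set e | exists x y, [/\ A x, A y & e = qh_dist G x y] ].

Definition rel_size G A : \bar R :=
  ereal_sup [set e | exists x y, [/\ A x, A y & e = (rel_dist G x y)%:E] ].

Definition natural_domain (psi : R -> R) G : Prop :=
  forall A : set E, A !=set0 -> connected A -> A `<=` G ->
    (rel_size G A < +oo)%E -> (qh_size G A <= (psi (fine (rel_size G A)))%:E)%E.

(* For t in [0, 1] the subarcs between gamma t and the endpoints x, y are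
   parametrized by [0, t] and [t, 1]. *)
Definition arc_in G x y gamma : Prop :=
  [/\ {within `[0, 1], continuous gamma}, {in `[0, 1] &, injective gamma},
      gamma @` `[0, 1] `<=` G, gamma 0 = x & gamma 1 = y].

(* An arc has distinct endpoints; for x = y the conditions below ask only for
   the degenerate arc {x}. *)
Definition uniform_domain (c : R) G : Prop :=
  forall x y, G x -> G y -> x != y ->
    exists gamma,
      [/\ arc_in G x y gamma,
          (curve_length gamma 0%R 1%R <= (c * `|x - y|)%:E)%E &
          forall t : R, 0 <= t <= 1 ->
            (Order.min (curve_length gamma 0%R t) (curve_length gamma t 1%R)
               <= (c * dist_bdry G (gamma t))%:E)%E].

Definition diameter_uniform_domain (c : R) G : Prop :=
  forall x y, G x -> G y -> x != y ->
    exists gamma,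
      [/\ arc_in G x y gamma,
          (diam (gamma @` `[0%R, 1%R]) <= (c * `|x - y|)%:E)%E &
          forall t : R, 0 <= t <= 1 ->
            (Order.min (diam (gamma @` `[0%R, t])) (diam (gamma @` `[t, 1%R]))
               <= (c * dist_bdry G (gamma t))%:E)%E].

Definition cross_ratio x y z w : R :=
  `|x - z| / `|x - y| * (`|y - w| / `|z - w|).

End BanachSpace.
Arguments dim_ge2 {R} E.

Section Maps.
Context {R : realType} {E E' : completeNormedModType R}.
Implicit Types (f : E -> E').

Definition CQH (M C : R) (G : set E) (G' : set E') f : Prop :=
  homeomorphism_on G G' f /\
  forall x y, G x -> G y ->
    (((M^-1)%:E * (qh_dist G x y - C%:E) <= qh_dist G' (f x) (f y)) /\
     (qh_dist G' (f x) (f y) <= M%:E * qh_dist G x y + C%:E))%E.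

(* Stated for maps between subsets of E and E' that do not contain the point at
   infinity, so that all cross ratios are finite ones. *)
Definition relative_quasimobius (eta : R -> R) (X0 A : set E) f : Prop :=
  homeomorphism_on X0 (f @` X0) f /\
  forall x y z w, X0 x -> X0 y -> X0 z -> X0 w -> uniq [:: x; y; z; w] ->
    (A x /\ A w) \/ (A y /\ A z) ->
    cross_ratio (f x) (f y) (f z) (f w) <= eta (cross_ratio x y z w).

End Maps.

(* Main.v *)
Require Import Defs.
From HB Require Import structures.
From mathcomp Require Import all_boot all_order all_algebra.
From mathcomp Require Import all_classical all_reals all_analysis.
From mathcomp Require Import measurable_realfun ring lra zify.
Set Implicit Arguments.
Unset Strict Implicit.
Unset Printing Implicit Defensive.
Import Order.TTheory GRing.Theory Num.Theory.
Import numFieldNormedType.Exports.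
Local Open Scope classical_set_scope.
Local Open Scope ring_scope.

(* Up to constants, k_G + 1 is the number of links of a shortest chain of points whose
   consecutive members are close compared with their distance to the boundary. If this
   number is O(1 + log (1 + r_G)), then G is uniform: along a shortest chain the boundary
   distance grows geometrically up to its maximum and then decays geometrically, and the
   polygon through a shortest chain is an arc.

   If the boundary is a single point, then G is a punctured space and the logarithmic
   bound is elementary. Otherwise r_G' (f x, f y) is bounded by a power of r_G (x, y),
   and conversely. Since infinity does not belong to the domains, this is not a mere
   computation with cross ratios when the boundary is bounded: one also needs that f maps
   points far from the boundary to such points, which follows from the CQH condition along
   a segment towards the boundary. Now a diameter uniform arc in G splits into
   O(1 + log (1 + r_G)) pieces A with r_G (A) bounded. Then r_G' (f A) is bounded, hence
   so is k_G' (f A) because G' is natural, hence so is k_G (A). This is the logarithmic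
   bound for G, and the comparison of r_G with r_G' carries it over to G'. *)

(** * Preliminaries on the real line and on boundary distances *)

(** Quasihyperbolic geodesics need not exist in an infinite-dimensional Banach space, nor need
    nearest boundary points; a shortest chain always exists, because its length is a natural number.
    Integrals therefore occur only in the translation between [qh_dist] and [chain]. The gauges are
    arbitrary, so neither can yield a logarithm by itself. Naturality is applied only to sets whose
    relative size is below one fixed constant, and [psi] enters through a single value; the
    logarithm comes from counting the pieces of the arc. Likewise [eta] enters through a bound on
    [[0, 4]] and a threshold near 0, and power type distortion is recovered from connectedness.
    Relative distances are bounded by [2 ^+ L] and all losses are exponents linear in [L.+1]. Such
    bounds compose, so a chain length linear in [L.+1] survives the passage from one domain to the
    other. Every constant is fixed before the spaces and domains are introduced, which is the reason
    for the many statements of the form [exists K, forall E G, ...]. *)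

Ltac nat_lia := match goal with R : realType |- _ => clear dependent R end; lia.

Section RealLine.
Context {R : realType}.
Implicit Types (a b t u : R).

Lemma within_continuous_epsP {V W : normedModType R} (A : set V) (f : V -> W) :
  {within A, continuous f} <->
  forall x : V, A x -> forall e : R, 0 < e ->
    exists2 d : R, 0 < d & forall y, A y -> `|x - y| < d -> `|f x - f y| < e.
Proof.
split.
- move=> /subspace_continuousP fc x Ax e e0.
  have /cvgrPdist_lt/(_ e e0) := fc x Ax.
  rewrite /prop_near1 /within /= => /nbhs_ballP [d /= d0 H].
  exists d => [//|y Ay xy]; apply: (H y) => //; rewrite -ball_normE; exact: xy.
- move=> H; apply/subspace_continuousP => x Ax.
  apply/cvgrPdist_lt => /= e e0.
  have [d d0 Hd] := H x Ax e e0.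
  rewrite /prop_near1 /within /=; apply/nbhs_ballP; exists d => //= y xy Ay.
  by apply: Hd => //; move: xy; rewrite -ball_normE.
Qed.

(** The hypothesis makes the failure of [P] relatively open in [[a, b]], so the infimum of the times
    at which [P] holds is itself such a time. This serves for exits from open sets, for levels of
    continuous functions and for prescribed arc lengths. *)
Lemma first_time (P : R -> Prop) a b : a <= b -> P b ->
  (forall t, a <= t <= b -> ~ P t ->
    exists2 d : R, 0 < d & forall u, a <= u <= b -> `|t - u| < d -> ~ P u) ->
  exists t1, [/\ a <= t1 <= b, P t1 & forall u, a <= u < t1 -> ~ P u].
Proof.
move=> ab Pb Pc; set S := [set t | a <= t <= b /\ P t].
have S0 : S b by split; rewrite ?ab ?lexx.
have lbS : lbound S a by move=> t [/andP[]].
have hS : has_inf S by split; [exists b | exists a].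
have aS : a <= inf S by apply: lb_le_inf => //; exists b.
have infS u : S u -> inf S <= u by move=> Su; apply: ge_inf => //; exists a.
exists (inf S); split; first by rewrite aS infS.
- apply: contrapT => nP.
  have [|//|d d0 Hd] := Pc (inf S); first by rewrite aS infS.
  have [t [tab Pt] td] := inf_adherent d0 hS.
  have it : inf S <= t by exact: infS.
  by apply: Hd Pt => //; rewrite ler0_norm; lra.
- move=> u /andP[au uS] Pu; suff : inf S <= u by lra.
  by have := infS _ S0 => ?; apply: infS; split => //; lra.
Qed.

Lemma first_hitting (h : R -> R) a b m : a <= b ->
  {within `[a, b], continuous h} -> h a <= m -> m <= h b ->
  exists t1, [/\ a <= t1 <= b, h t1 = m & forall u, a <= u <= t1 -> h u <= m].
Proof.
move=> ab /within_continuous_epsP hc ha hb.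
have [|t1 [tab ht H]] := @first_time (fun t => m <= h t) a b ab hb.
  move=> t tab /negP; rewrite -ltNge => tm.
  have [||d d0 Hd] := hc t _ (m - h t); rewrite /= ?in_itv ?subr_gt0 //=.
  exists d => // u uab tu; have := Hd u _ tu; rewrite /= in_itv /= => /(_ uab).
  rewrite ltr_norml => /andP[]; lra.
have H' u : a <= u < t1 -> h u < m by move/H/negP; rewrite -ltNge.
have e : h t1 = m.
  apply/eqP; rewrite eq_le ht andbT; rewrite leNgt; apply/negP => lt.
  have at1 : a < t1.
    by rewrite lt_neqAle; apply/andP; split; [apply/eqP => E; move: lt; rewrite -E; lra|lra].
  have [||d d0 Hd] := hc t1 _ (h t1 - m); rewrite /= ?in_itv ?subr_gt0 //=.
  set u := Num.max a (t1 - d / 2).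
  have au : a <= u by rewrite le_max lexx.
  have ut : u < t1 by rewrite gt_max at1 /=; lra.
  have ud : t1 - d / 2 <= u by rewrite le_max lexx orbT.
  have := Hd u; rewrite /= in_itv /=.
  have -> : a <= u <= b by lra.
  rewrite ger0_norm; last lra.
  move=> /(_ isT) /(_ ltac:(lra)); rewrite ltr_norml => /andP[_].
  by have := H' u; rewrite au ut => /(_ isT); lra.
exists t1; split => // u /andP[au]; rewrite le_eqVlt => /predU1P[->|ut].
  by rewrite e.
by apply/ltW/H'; rewrite au.
Qed.

End RealLine.

Section Distance.
Context {R : realType} {E : completeNormedModType R}.
Implicit Types (G : set E) (x y z a : E).

Lemma dist_bdry_ge0 G x : 0 <= dist_bdry G x.
Proof.
rewrite /dist_bdry; have [->|/set0P[b Gb]] := eqVneq (bdry G) set0.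
  by rewrite image_set0 inf0.
by apply: lb_le_inf => [|_ [z _ <-]//]; exists `|x - b|, b.
Qed.

Lemma dist_bdry_le G x a : bdry G a -> dist_bdry G x <= `|x - a|.
Proof.
move=> Ga; apply: ge_inf; last by exists a.
by exists 0 => _ [z _ <-].
Qed.

Lemma dist_bdry_approx G x (e : R) : bdry G !=set0 -> 0 < e ->
  exists2 a, bdry G a & `|x - a| < dist_bdry G x + e.
Proof.
move=> [b Gb] e0; have [|_ [a Ga <-] ae] := @inf_adherent _ [set `|x - z| | z in bdry G] _ e0.
  by split; [exists `|x - b|, b | exists 0 => _ [z _ <-]].
by exists a.
Qed.

Lemma dist_bdry_lip G x y : bdry G !=set0 ->
  dist_bdry G x <= dist_bdry G y + `|x - y|.
Proof.
move=> G0; rewrite leNgt; apply/negP => lt.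
have [|a Ga ya] := dist_bdry_approx y G0 (e := dist_bdry G x - (dist_bdry G y + `|x - y|)).
  by rewrite subr_gt0.
have := dist_bdry_le x Ga; have := ler_distD y x a; lra.
Qed.

Lemma dist_line x v (s t : R) :
  `|(x + s *: v) - (x + t *: v)| = `|s - t| * `|v|.
Proof. by rewrite opprD addrACA subrr add0r -scalerBl normrZ. Qed.

(** At the first time outside the open set [G] the point is a limit of earlier points of the
    segment, which lie in [G]. *)
Lemma segment_exit G x z : open G -> G x -> ~ G z ->
  exists t : R, [/\ 0 < t <= 1, bdry G (x + t *: (z - x)) &
    forall s, 0 <= s < t -> G (x + s *: (z - x))].
Proof.
move=> Go Gx nGz.
have [|||t [/andP[t0 t1] nG H]] := @first_time R (fun t => ~ G (x + t *: (z - x))) 0 1.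
- by rewrite ler01.
- by rewrite scale1r addrC subrK.
- move=> t _ /contrapT Gt; have /nbhs_ballP := open_nbhs_nbhs (conj Go Gt) => -[e /= e0 He].
  exists (e / (`|z - x| + 1)); first by rewrite divr_gt0 // ltr_wpDl.
  move=> u _ tu nG; apply: nG; apply: He; rewrite -ball_normE /= dist_line.
  move: tu; rewrite ltr_pdivlMr ?ltr_wpDl// mulrDr.
  by have := normr_ge0 (t - u); lra.
exists t.
have t0' : 0 < t.
  rewrite lt_neqAle t0 andbT; apply/eqP => E0; apply: nG.
  by rewrite -E0 scale0r addr0.
have HG s : 0 <= s < t -> G (x + s *: (z - x)) by move=> /H/contrapT.
split => //; first by rewrite t0' t1.
split => // B /nbhs_ballP [e /= e0 He].
set k := `|z - x| + 1; have k0 : 0 < k by rewrite ltr_wpDl.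
set s := Num.max 0 (t - e / k / 2).
have ek : 0 < e / k by rewrite divr_gt0.
have s0 : 0 <= s by rewrite le_max lexx.
have st : s < t by rewrite gt_max t0' /=; lra.
have es : t - e / k / 2 <= s by rewrite le_max lexx orbT.
exists (x + s *: (z - x)); split; first by apply: HG; rewrite s0.
apply: He; rewrite -ball_normE /= dist_line ger0_norm; last lra.
have : (t - s) * k < e by rewrite -ltr_pdivlMr //; lra.
by rewrite /k mulrDr; lra.
Qed.

End Distance.

(** * Chains of relatively close points *)

Section Chains.
Context {R : realType} {E : completeNormedModType R}.
Implicit Types (G : set E) (x y z p q : E).

(** Both endpoints are compared with their boundary distances to make the relation symmetric. With
    the factor 4, linked points have boundary distances within the ratio 5/4, and the segment
    between linked points of [G] stays in [G]. The relation is reflexive, so a chain can be padded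
    and [chain G n] means at most [n] links. *)
Definition link G p q :=
  4 * `|p - q| <= dist_bdry G p /\ 4 * `|p - q| <= dist_bdry G q.

Definition chain G (n : nat) x y := exists p : nat -> E,
  [/\ p 0%N = x, p n = y & forall i, (i < n)%N -> link G (p i) (p i.+1)].

Lemma ball_dist_bdry G x y : open G -> G x -> `|x - y| < dist_bdry G x -> G y.
Proof.
move=> Go Gx xy; apply: contrapT => nGy.
have [t [/andP[t0 t1] bt _]] := segment_exit Go Gx nGy.
have := dist_bdry_le x bt; rewrite opprD addNKr normrN normrZ gtr0_norm// distrC.
by have := normr_ge0 (x - y); move: xy t1; nra.
Qed.

Lemma dist_bdry_gt0 G x : open G -> bdry G !=set0 -> G x -> 0 < dist_bdry G x.
Proof.
move=> Go [b Gb] Gx; have /nbhs_ballP[e /= e0 He] := open_nbhs_nbhs (conj Go Gx).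
apply: (lt_le_trans e0); apply: lb_le_inf => [|_ [a [_ nGa] <-]].
  by exists `|x - b|, b.
by rewrite leNgt; apply/negP => xa; apply: nGa; apply: He; rewrite -ball_normE.
Qed.

Lemma link_sym G p q : link G p q -> link G q p.
Proof. by move=> [? ?]; split; rewrite distrC. Qed.

Lemma linkxx G p : link G p p.
Proof. by split; rewrite subrr normr0 mulr0 dist_bdry_ge0. Qed.

Lemma link_in G p q : open G -> bdry G !=set0 -> G p -> link G p q -> G q.
Proof.
move=> Go G0 Gp [pq _]; apply: (ball_dist_bdry Go Gp).
have := dist_bdry_gt0 Go G0 Gp; lra.
Qed.

Lemma link_close G p q : bdry G !=set0 ->
  5 * `|p - q| <= dist_bdry G p -> link G p q.
Proof.
move=> G0 pq; have := dist_bdry_lip p q G0; have := normr_ge0 (p - q).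
by split; lra.
Qed.

Lemma link_dist_bdry G p q : bdry G !=set0 -> link G p q ->
  4 * dist_bdry G p <= 5 * dist_bdry G q.
Proof.
by move=> G0 [h1 h2]; have := dist_bdry_lip p q G0; lra.
Qed.

Lemma chainxx G n x : chain G n x x.
Proof. by exists (fun=> x); split => // i _; exact: linkxx. Qed.

Lemma chain1 G x y : link G x y -> chain G 1 x y.
Proof. by move=> h; exists (fun i => if i is 0%N then x else y); split => // -[]. Qed.

Lemma chain_sym G n x y : chain G n x y -> chain G n y x.
Proof.
move=> [p [<- <- pl]]; exists (fun i => p (n - i)%N); split.
- by rewrite subn0.
- by rewrite subnn.
- move=> i lt; have -> : (n - i = (n - i.+1).+1)%N by lia.
  by apply/link_sym/pl; lia.
Qed.

Lemma chain_trans G m n x y z :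
  chain G m x y -> chain G n y z -> chain G (m + n) x z.
Proof.
move=> [p [<- <- pl]] [q [q0 <- ql]].
exists (fun i => if (i <= m)%N then p i else q (i - m)%N); split.
- by [].
- case: leqP => h; last by congr q; lia.
  have n0 : n = 0%N by lia.
  by subst n; rewrite addn0 q0.
- move=> i lt; case: (ltnP i m) => im.
    by rewrite ltnW //; exact: pl.
  case: leqP => im'; last by rewrite subSn //; apply: ql; lia.
  have -> : i = m by lia.
  by rewrite -q0 subSnn; apply: ql; lia.
Qed.

Lemma chain_le G m n x y : (m <= n)%N -> chain G m x y -> chain G n x y.
Proof.
by move=> mn h; rewrite -(subnKC mn); apply: chain_trans h (chainxx _ _ _).
Qed.

Lemma chain_in G n x y : open G -> bdry G !=set0 -> G x -> chain G n x y -> G y.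
Proof.
move=> Go G0 Gx [p [p0 <- pl]].
suff : forall i, (i <= n)%N -> G (p i) by apply.
elim=> [|i IH] lt; first by rewrite p0.
by apply: link_in (pl _ lt) => //; apply: IH; exact: ltnW.
Qed.

Lemma chain_dist_bdry G n x y : bdry G !=set0 -> chain G n x y ->
  dist_bdry G x <= 2 ^+ n * dist_bdry G y.
Proof.
move=> G0 [p [<- <- pl]].
suff : forall i, (i <= n)%N -> dist_bdry G (p 0%N) <= 2 ^+ i * dist_bdry G (p i) by apply.
elim=> [|i IH] lt; first by rewrite expr0 mul1r.
apply: (le_trans (IH (ltnW lt))); rewrite exprSr -mulrA ler_wpM2l ?exprn_ge0 //.
by have := link_dist_bdry G0 (pl _ lt); have := dist_bdry_ge0 G (p i.+1); lra.
Qed.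

Lemma chain_segment G x y (n : nat) (r : R) : (0 < n)%N ->
  (forall t : R, 0 <= t <= 1 -> r <= dist_bdry G (x + t *: (y - x))) ->
  4 * `|y - x| <= n%:R * r -> chain G n x y.
Proof.
move=> n0 hr xy; have n0' : 0 < n%:R :> R by rewrite ltr0n.
exists (fun i => x + (i%:R / n%:R) *: (y - x)); split.
- by rewrite mul0r scale0r addr0.
- by rewrite divff ?gt_eqF// scale1r addrC subrK.
- have hi i : (i <= n)%N -> r <= dist_bdry G (x + (i%:R / n%:R) *: (y - x)).
    by move=> lt; apply: hr; rewrite divr_ge0 //= ler_pdivrMr // mul1r ler_nat.
  move=> i lt; rewrite /link dist_line distrC -mulrBl -natrB // subSnn mul1r.
  have h : 4 * (`|n%:R^-1| * `|y - x|) <= r.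
    rewrite ger0_norm ?invr_ge0 // mulrCA mulrC ler_pdivrMr // mulrC.
    by rewrite mulrC (mulrC r); lra.
  by split; apply: (le_trans h); apply: hi => //; exact: ltnW.
Qed.

End Chains.

(** * Growth along quasigeodesic sequences *)

Section Growth.

(** For [q = n / (K + 1)] and [L = q - 1] the bound [n <= K * q] fails, so [2 ^ (q - 1) < A * n],
    which is linear in [q]. Splitting the power into two factors and bounding each below by its
    exponent shows that this is impossible for large [q]. *)
Lemma linear_exp_bound (K A : nat) : exists N : nat, forall n : nat,
  (forall L : nat, (A * n <= 2 ^ L)%N -> (n <= K * L.+1)%N) -> (n <= N)%N.
Proof.
pose B := (A * K.+1)%N.
exists ((4 * B + 4) * K.+1)%N => n H; rewrite leqNgt; apply/negP => lt.
pose q := (n %/ K.+1)%N.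
have qB : (4 * B + 4 <= q)%N by rewrite leq_divRL // ltnW.
have nq : (n < q.+1 * K.+1)%N by rewrite ltn_ceil.
have qn : (q * K.+1 <= n)%N by rewrite leq_divM.
have q0 : q = q.-1.+1 by lia.
have [h|h] := leqP n (K * q.-1.+1); first by nia.
suff /H : (A * n <= 2 ^ q.-1)%N by lia.
apply: (@leq_trans (2 ^ (2 * B) * 2 ^ (q.-1 - 2 * B))); last first.
  by rewrite -expnD leq_exp2l //; lia.
have h1 := ltn_expl (2 * B) (isT : 1 < 2)%N.
have h2 := ltn_expl (q.-1 - 2 * B) (isT : 1 < 2)%N.
apply: (@leq_trans (2 * B * (q.-1 - 2 * B))); last by apply: leq_mul; lia.
apply: (@leq_trans (A * (q.+1 * K.+1))); first by rewrite leq_mul2l ltnW ?orbT.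
rewrite mulnCA -/B mulnC (mulnC 2 B) -mulnA leq_mul2l; apply/orP; right; lia.
Qed.

Context {R : realType}.

(* Here [d i] is the boundary distance of the [i]-th point of a shortest chain and [m] is
   an index at which it is maximal; [gs_long] expresses that the chain is shortest in a
   domain where chains of logarithmic length exist. *)
Record growth_seq (N : nat -> nat) (d : nat -> R) (m : nat) : Prop := {
  gs_gt0 : forall i, (i <= m)%N -> 0 < d i;
  gs_le2 : forall i, (i < m)%N -> d i <= 2 * d i.+1 /\ d i.+1 <= 2 * d i;
  gs_max : forall i, (i <= m)%N -> d i <= d m;
  gs_long : forall A i j, (i < j <= m)%N ->
    (forall k, (i <= k <= j)%N -> d k <= 2 ^+ A * d i /\ d k <= 2 ^+ A * d j) ->
    (j - i <= N A)%N }.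

Lemma growth_iter N d m i k : growth_seq N d m -> (i <= k <= m)%N ->
  d i <= 2 ^+ (k - i) * d k.
Proof.
move=> gs; move e : (k - i)%N => n; elim: n k e => [|n IH] k e ikm.
  have -> : k = i by lia.
  by rewrite expr0 mul1r.
have -> : k = k.-1.+1 by lia.
apply: (le_trans (IH k.-1 _ _)); [lia|lia|].
rewrite exprSr -mulrA ler_wpM2l ?exprn_ge0 //.
by case: (@gs_le2 _ _ _ gs k.-1) => //; lia.
Qed.

(** If [d k < d i], take the maximal stretch around [k] on which [d] stays below [d i]; it closes on
    the right because [d m] is maximal. At both ends [d] lies between [d i] and [2 * d i], so
    [gs_long] with [A = 1] bounds the length of the stretch, and [d] loses at most a factor 2 per
    step. *)
Lemma growth_quasi_monotone N d m i k : growth_seq N d m -> (i <= k <= m)%N ->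
  d i <= 2 ^+ N 1%N * d k.
Proof.
move=> gs ikm; have dk0 := gs_gt0 gs (_ : k <= m)%N.
have [ik|ki] := leP (d i) (d k).
  apply: (le_trans ik); rewrite ler_peMl ?exprn_ege1 // ?ler1n// ltW // dk0; lia.
have exI : exists j, (i <= j <= k)%N && (d i <= d j) by exists i; rewrite lexx; lia.
have exJ : exists j, (k <= j <= m)%N && (d i <= d j).
  by exists m; rewrite (gs_max gs) ?leqnn //; lia.
have ubI j : (i <= j <= k)%N && (d i <= d j) -> (j <= k)%N by lia.
case: (ex_maxnP exI ubI) => i' /andP[i'ik di'] maxi'.
case: (ex_minnP exJ) => j' /andP[j'km dj'] minj'.
have i'k : (i' < k)%N.
  by rewrite ltn_neqAle; apply/andP; split; [apply/eqP => E; move: di'; rewrite E; lra|lia].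
have kj' : (k < j')%N.
  by rewrite ltn_neqAle; apply/andP; split; [apply/eqP => E; move: dj'; rewrite -E; lra|lia].
have between l : (i' < l < j')%N -> d l < d i.
  move=> lij; rewrite ltNge; apply/negP => dl.
  have [lk|kl] := leqP l k.
    by have := maxi' l; rewrite dl andbT; lia.
  by have := minj' l; rewrite dl andbT; lia.
have di0 : 0 < d i by apply: (gs_gt0 gs); lia.
have di'2 : d i' <= 2 * d i.
  have [h _] := @gs_le2 _ _ _ gs i' ltac:(lia).
  by have := between i'.+1 ltac:(lia); lra.
have dj'2 : d j' <= 2 * d i.
  have [_ h] := @gs_le2 _ _ _ gs j'.-1 ltac:(lia).
  move: h; have -> : j'.-1.+1 = j' by lia.
  by have := between j'.-1 ltac:(lia); lra.
have len : (j' - i' <= N 1%N)%N.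
  apply: (gs_long gs); first lia.
  move=> l lij; rewrite expr1.
  suff : d l <= 2 * d i by split; lra.
  have [->//|nl] := eqVneq l i'; have [->//|nl'] := eqVneq l j'.
  by have := between l ltac:(lia); lra.
apply: (le_trans di'); apply: (le_trans (@growth_iter _ _ _ i' k gs _)); first lia.
rewrite ler_wpM2r ?(ltW (dk0 _)) //; first lia.
by apply: ler_weXn2l; [rewrite ler1n|lia].
Qed.

(** Were [d k < 2 * d i], quasi-monotonicity would keep [d] on the whole stretch below
    [2 ^+ (N 1).+1] times its value at either end, and [gs_long] would make the stretch short. *)
Lemma growth_double N d m i k : growth_seq N d m -> (i < k <= m)%N ->
  (N (N 1%N).+1 < k - i)%N -> 2 * d i <= d k.
Proof.
move=> gs ikm long; rewrite leNgt; apply/negP => lt.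
suff : (k - i <= N (N 1%N).+1)%N by rewrite leqNgt long.
apply: (gs_long gs) => // l ilk.
have h := @growth_quasi_monotone _ _ _ l k gs ltac:(lia).
have dl0 : 0 < d l by apply: (gs_gt0 gs); lia.
have p0 : 0 < 2 ^+ N 1%N :> R by rewrite exprn_gt0.
have e : 2 ^+ (N 1%N).+1 = 2 * 2 ^+ N 1%N :> R by rewrite exprS.
by rewrite e; split; nra.
Qed.

(** Cut off the last [T] terms. They contribute at most half of the bound, and [d] at the cut is at
    most half of [d i], so the terms before it contribute at most the other half by induction. *)
Lemma growth_sum (N : nat -> nat) : exists2 B : R, 0 <= B & forall d m,
  growth_seq N d m -> forall i, (i <= m)%N -> \sum_(j < i) d j <= B * d i.
Proof.
pose T := (N (N 1%N).+1).+1.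
exists (2 * (2 ^+ N 1%N * T%:R)); first by rewrite !mulr_ge0 ?exprn_ge0.
move=> d m gs i; elim: i {-2}i (leqnn i) => [|n IH] i.
  by rewrite leqn0 => /eqP-> h; rewrite big_ord0 !mulr_ge0 ?exprn_ge0// ltW // (gs_gt0 gs).
move=> iln im.
have di0 : 0 < d i by exact: (gs_gt0 gs).
have tail a : (a <= i)%N -> (i - a <= T)%N ->
    \sum_(a <= j < i) d j <= 2 ^+ N 1%N * T%:R * d i.
  move=> ai aT; apply: (@le_trans _ _ (\sum_(a <= j < i) 2 ^+ N 1%N * d i)).
    rewrite !big_nat; apply: ler_sum => j /andP[aj ji].
    by apply: (@growth_quasi_monotone N d m) => //; lia.
  rewrite sumr_const_nat -[_ *+ (i - a)]mulr_natr mulrAC.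
  by rewrite ler_wpM2r ?(ltW di0)// ler_wpM2l ?exprn_ge0 // ler_nat.
have [iT|Ti] := leqP i T.
  rewrite -(big_mkord xpredT); apply: (le_trans (tail 0%N _ _)); [lia|lia|].
  have c0 : 0 <= 2 ^+ N 1%N * T%:R * d i by rewrite !mulr_ge0 ?exprn_ge0// ltW.
  lra.
rewrite -(big_mkord xpredT) (@big_cat_nat _ _ _ (i - T)) //=; last lia.
have /IH : (i - T <= n)%N by lia.
rewrite big_mkord => /(_ ltac:(lia)) h1.
have h2 := tail (i - T)%N ltac:(lia) ltac:(lia).
have h3 := @growth_double _ _ _ (i - T)%N i gs ltac:(lia) ltac:(lia).
have c0 : 0 <= 2 ^+ N 1%N * T%:R :> R by rewrite mulr_ge0 ?exprn_ge0.
have := ler_wpM2l c0 h3; lra.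
Qed.

End Growth.

(** * Length of curves *)

Section CurveLength.
Context {R : realType} {E : completeNormedModType R}.
Implicit Types (gamma : R -> E) (a b c : R).

Local Notation polygon_length gamma a b s := (\sum_(i < size s)
  `|gamma (nth b (a :: s) i.+1) - gamma (nth b (a :: s) i)|).

(** Each partition sum is dominated by a telescoping sum. [F] may be discontinuous: choosing it with
    a jump is how continuity properties of arc length are proved below. *)
Lemma curve_length_le gamma (F : R -> R) a b :
  (forall s t, a <= s -> s <= t -> t <= b -> `|gamma t - gamma s| <= F t - F s) ->
  (curve_length gamma a b <= (F b - F a)%:E)%E.
Proof.
move=> HF; apply: ub_ereal_sup => _ [s [sp /eqP sl] <-]; rewrite lee_fin.
elim: s a HF sp sl => [a _ _ /= -> |x s IH a HF /= /andP[ax xp] sl].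
  by rewrite big_ord0 subrr.
rewrite big_ord_recl /=.
have xb : x <= b by rewrite -sl; apply: (@itv_partition_le _ _ x (last x s) s); split.
have h := HF a x (lexx _) (ltW ax) xb.
have h2 : polygon_length gamma x b s <= F b - F x.
  by apply: IH => // u t xu; apply: HF; apply: le_trans xu; exact: ltW.
by apply: (le_trans (lerD h h2)); lra.
Qed.

Lemma curve_length_chord gamma a b : a <= b ->
  (`|gamma b - gamma a|%:E <= curve_length gamma a b)%E.
Proof.
rewrite le_eqVlt => /predU1P[->|ab]; apply: ereal_sup_ubound.
  by exists [::]; [split | rewrite big_ord0 subrr normr0].
exists [:: b]; first exact: itv_partition1.
by rewrite big_ord_recl big_ord0 addr0.
Qed.

Lemma curve_length_ge0 gamma a b : a <= b -> (0 <= curve_length gamma a b)%E.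
Proof. by move=> /(curve_length_chord gamma); apply: le_trans; rewrite lee_fin. Qed.

Lemma curve_length_cat gamma a b c : a <= b -> b <= c ->
  (curve_length gamma a b + curve_length gamma b c <= curve_length gamma a c)%E.
Proof.
move=> ab bc.
have H s1 s2 : itv_partition a b s1 -> itv_partition b c s2 ->
    ((polygon_length gamma a b s1)%:E + (polygon_length gamma b c s2)%:E <=
    curve_length gamma a c)%E.
  move=> p1 p2; apply: ereal_sup_ubound; exists (s1 ++ s2).
    exact: itv_partition_cat p1 p2.
  rewrite -EFinD; congr EFin.
  case: p1 => p1 /eqP; elim: s1 a {ab p1} => [a /= <-|x s IH a /= sl].
    by rewrite big_ord0 add0r.
  by rewrite !big_ord_recl /= (IH x sl) addrA.
have H2 s1 : itv_partition a b s1 ->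
   ((polygon_length gamma a b s1)%:E + curve_length gamma b c <= curve_length gamma a c)%E.
  move=> p1; rewrite addeC -leeBrDr //; apply: ub_ereal_sup => _ [s2 p2 <-].
  by rewrite leeBrDr // addeC; exact: H.
have [bcf|] := boolP (curve_length gamma b c \is a fin_num).
  rewrite -leeBrDr //; apply: ub_ereal_sup => _ [s1 p1 <-].
  by rewrite leeBrDr //; exact: H2.
rewrite ge0_fin_numE ?curve_length_ge0 // -leNgt leye_eq => /eqP bcoo.
have [s1 p1] : exists s1, itv_partition a b s1.
  move: ab; rewrite le_eqVlt => /predU1P[->|ab]; first by exists [::].
  by exists [:: b]; exact: itv_partition1.
by have := H2 _ p1; rewrite bcoo addey // leye_eq => /eqP ->; rewrite leey.
Qed.

End CurveLength.

Section RectifiableCurves.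
Context {R : realType} {E : completeNormedModType R}.
Variable gamma : R -> E.
Hypothesis gamma_cont : {within `[0, 1], continuous gamma}.
Hypothesis gamma_rect : (curve_length gamma 0%R 1%R < +oo)%E.
Implicit Types s t : R.

Lemma curve_length_fin s t : 0 <= s -> s <= t -> t <= 1 ->
  curve_length gamma s t \is a fin_num.
Proof.
move=> s0 st t1; rewrite ge0_fin_numE ?curve_length_ge0 //; apply: le_lt_trans gamma_rect.
have := curve_length_cat gamma (le_trans s0 st) t1; apply: le_trans.
apply: le_trans (leeDl _ (curve_length_ge0 _ t1)).
by apply: le_trans (curve_length_cat gamma s0 st); rewrite leeDr ?curve_length_ge0.
Qed.

Definition arclen t : R := fine (curve_length gamma 0%R t).

Lemma arclenE t : 0 <= t <= 1 -> curve_length gamma 0%R t = (arclen t)%:E.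
Proof. by move=> /andP[t0 t1]; rewrite fineK // curve_length_fin. Qed.

Lemma curve_length_arclen_ge s t : 0 <= s -> s <= t -> t <= 1 ->
  (curve_length gamma s t <= (arclen t - arclen s)%:E)%E.
Proof.
move=> s0 st t1; rewrite EFinB -!arclenE ?s0 ?(le_trans s0 st) ?t1 ?(le_trans st)//.
rewrite leeBrDr; last by rewrite curve_length_fin // (le_trans st).
by rewrite addeC; apply: curve_length_cat.
Qed.

Lemma arclen_chord s t : 0 <= s -> s <= t -> t <= 1 ->
  `|gamma t - gamma s| <= arclen t - arclen s.
Proof.
move=> s0 st t1; rewrite -lee_fin.
exact: le_trans (curve_length_chord _ st) (curve_length_arclen_ge s0 st t1).
Qed.

Lemma arclen_homo s t : 0 <= s -> s <= t -> t <= 1 -> arclen s <= arclen t.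
Proof.
by move=> s0 st t1; rewrite -subr_ge0; apply: le_trans (arclen_chord s0 st t1).
Qed.

Lemma arclen0 : arclen 0 = 0.
Proof.
apply/eqP; rewrite eq_le -!lee_fin -arclenE ?lexx ?ler01 // curve_length_ge0 // andbT.
have := @curve_length_le _ _ gamma (fun=> 0) 0 0; rewrite subrr; apply => s t s0 st t0.
have -> : s = t by lra.
by rewrite !subrr normr0.
Qed.

(** This is subadditivity of length. [F] is the arc length up to [s], continued by the length
    measured from [s]; a chord that crosses [s] is split there by the triangle inequality. *)
Lemma curve_length_arclen_le s t : 0 <= s -> s <= t -> t <= 1 ->
  ((arclen t - arclen s)%:E <= curve_length gamma s t)%E.
Proof.
move=> s0 st t1; have fin u v := @curve_length_fin u v.
rewrite -(@fineK _ (curve_length gamma s t)) ?fin //; rewrite lee_fin.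
set Lt := fine _.
pose F u := if u <= s then arclen u else arclen s + fine (curve_length gamma s u).
have key : (curve_length gamma 0%R t <= (F t - F 0)%:E)%E.
  apply: curve_length_le => u v u0 uv vt; have v1 := le_trans vt t1; rewrite /F.
  case: ifPn => [vs|]; first by rewrite (le_trans uv vs); exact: arclen_chord.
  rewrite -ltNge => sv; case: ifPn => [us|].
    apply: (le_trans (ler_distD (gamma s) _ _)).
    have h1 := arclen_chord u0 us (le_trans st t1).
    have h2 : `|gamma v - gamma s| <= fine (curve_length gamma s v).
      by rewrite -lee_fin fineK ?curve_length_chord // ?fin // ltW.
    lra.
  rewrite -ltNge => su.
  suff : `|gamma v - gamma u| + fine (curve_length gamma s u) <=
    fine (curve_length gamma s v) by lra.
  rewrite -lee_fin EFinD !fineK ?fin // ?(ltW su) ?(ltW sv) ?(le_trans uv) //.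
  rewrite addeC; apply: le_trans (curve_length_cat gamma (ltW su) uv).
  by rewrite leeD2l // curve_length_chord.
move: key; rewrite arclenE ?t1 ?(le_trans s0) // lee_fin /F s0 arclen0.
case: ifPn => [ts|_]; last by rewrite /Lt; lra.
have -> : t = s by lra.
by move=> _; rewrite subrr /Lt fine_ge0 // curve_length_ge0.
Qed.

(** If arc length jumped at [t] to at least [s], then [F], which starts from the value [s], would
    bound the length of the rest of the curve by [arclen 1 - s], less than it is. Chords that start
    at [t] are handled by starting a little later, at a cost that vanishes since [gamma] is
    continuous. *)
Lemma arclen_right_cont t s : 0 <= t < 1 -> arclen t < s ->
  exists2 u, t < u <= 1 & arclen u < s.
Proof.
move=> /andP[t0 t1] ts; apply: contrapT => H.
have {}H u : t < u <= 1 -> s <= arclen u.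
  by move=> tu; rewrite leNgt; apply/negP => us; apply: H; exists u.
have := curve_length_arclen_le t0 (ltW t1) (lexx 1).
apply/negP; rewrite -ltNge.
pose F u := if u <= t then s else arclen u.
apply: (@le_lt_trans _ _ (F 1 - F t)%:E); last first.
  by rewrite lte_fin /F lexx leNgt t1 /=; lra.
apply: curve_length_le => u v tu uv v1; rewrite /F.
case: ifPn => [vt|]; first by rewrite (le_trans uv vt) (_ : u = v) ?subrr ?normr0 //; lra.
rewrite -ltNge => tv; case: ifPn => [ut|]; last first.
  by move=> ut; apply: arclen_chord => //; lra.
have -> : u = t by lra.
apply/ler_addgt0Pr => e e0.
have [|d d0 Hd] := (within_continuous_epsP _ _).1 gamma_cont t _ e e0.
  by rewrite /= in_itv /= t0 ltW.
set w := Num.min v (t + d / 2).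
have wt : t < w by rewrite lt_min tv /=; lra.
have wv : w <= v by rewrite ge_min lexx.
have wd : w <= t + d / 2 by rewrite ge_min lexx orbT.
have := Hd w; rewrite /= in_itv /= => /(_ ltac:(lra)).
rewrite ler0_norm; last lra.
move=> /(_ ltac:(lra)) h1.
have h2 := @arclen_chord w v ltac:(lra) wv v1.
have h3 := H w ltac:(lra).
have := ler_distD (gamma w) (gamma v) (gamma t); rewrite (distrC (gamma w)).
move: h1; lra.
Qed.

(** The first time with [s <= arclen t] exists by right continuity and monotonicity. There arc
    length cannot exceed [s]: the same argument applies from the left, with [F] cut down to [s] at
    the end. *)
Lemma arclen_surj s : 0 <= s <= arclen 1 ->
  exists2 t, 0 <= t <= 1 & arclen t = s.
Proof.
move=> /andP[s0 s1].
have [|t1 [/andP[t10 t11] Pt H]] := @first_time R (fun t => s <= arclen t) 0 1 ler01 s1.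
  move=> t /andP[t0 t1] /negP; rewrite -ltNge => ts.
  have tlt : t < 1.
    by rewrite lt_neqAle t1 andbT; apply/eqP => E1; move: ts s1; rewrite E1; lra.
  have [|u /andP[tu u1] us] := @arclen_right_cont t s _ ts; first by rewrite t0.
  exists (u - t); first by rewrite subr_gt0.
  move=> v /andP[v0 v1] tv sv; have vu : v <= u.
    by move: tv; rewrite ltr_norml => /andP[]; lra.
  by have := arclen_homo v0 vu u1; lra.
exists t1; first by rewrite t10.
apply/eqP; rewrite eq_le Pt andbT; rewrite -lee_fin -arclenE ?t10 //.
pose F u := if u < t1 then arclen u else s.
have [t1E|tn0] := eqVneq t1 0; first by rewrite t1E arclenE ?lexx ?ler01 // arclen0 lee_fin.
have t1p : 0 < t1 by rewrite lt_neqAle eq_sym tn0.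
apply: (@le_trans _ _ (F t1 - F 0)%:E); last first.
  by rewrite lee_fin /F ltxx t1p arclen0 subr0.
apply: curve_length_le => u v u0 uv vt; rewrite /F.
case: ifPn => [vlt|]; first by rewrite (le_lt_trans uv vlt); apply: arclen_chord => //; lra.
rewrite -leNgt => tv; case: ifPn => [ult|]; last first.
  rewrite -leNgt => ?; have -> : u = v by lra.
  by rewrite !subrr normr0.
have -> : v = t1 by lra.
apply/ler_addgt0Pr => e e0.
have [|d d0 Hd] := (within_continuous_epsP _ _).1 gamma_cont t1 _ e e0.
  by rewrite /= in_itv /= t10.
set w := Num.max u (t1 - d / 2).
have wt : w < t1 by rewrite gt_max ult /=; lra.
have uw : u <= w by rewrite le_max lexx.
have wd : t1 - d / 2 <= w by rewrite le_max lexx orbT.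
have := Hd w; rewrite /= in_itv /= => /(_ ltac:(lra)).
rewrite ger0_norm; last lra.
move=> /(_ ltac:(lra)) h1.
have h2 := @arclen_chord u w ltac:(lra) uw ltac:(lra).
have h3 := H w ltac:(lra).
have {h3} : arclen w < s by rewrite ltNge; apply/negP.
by have := ler_distD (gamma w) (gamma t1) (gamma u); lra.
Qed.

End RectifiableCurves.

(** * From quasihyperbolic distance to chains *)

Section LineIntegral.
Context {R : realType} {E : completeNormedModType R}.
Variables (G : set E) (gamma : R -> E).
Hypothesis G_open : open G.
Hypothesis G_bdry : bdry G !=set0.
Hypothesis gamma_cont : {within `[0, 1], continuous gamma}.
Hypothesis gamma_in : gamma @` `[0, 1] `<=` G.
Hypothesis gamma_rect : (curve_length gamma 0%R 1%R < +oo)%E.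
Implicit Types s t : R.
Let L := arclen gamma 1.
Let density s := (dist_bdry G (arc_length_param gamma s))^-1.

Lemma arc_length_paramP s : 0 <= s <= L ->
  exists t, [/\ 0 <= t <= 1, arclen gamma t = s & arc_length_param gamma s = gamma t].
Proof.
move=> sL; have [t t01 ts] := arclen_surj gamma_cont gamma_rect sL.
rewrite /arc_length_param; case: xgetP => [u _ [u01 us]|/(_ t)[]].
  by exists u; split => //; apply: EFin_inj; rewrite -arclenE.
by split => //; rewrite arclenE // ts.
Qed.

Lemma arclen_chord_norm s t : 0 <= s <= 1 -> 0 <= t <= 1 ->
  `|gamma s - gamma t| <= `|arclen gamma s - arclen gamma t|.
Proof.
move=> /andP[s0 s1] /andP[t0 t1]; have [st|/ltW ts] := leP s t.
  by rewrite distrC (distrC (arclen _ _)) [leRHS]ger0_norm ?subr_ge0 ?arclen_homo ?arclen_chord.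
by rewrite [leRHS]ger0_norm ?subr_ge0 ?arclen_homo ?arclen_chord.
Qed.

Lemma density_cont : {within `[0, L], continuous density}.
Proof.
rewrite (_ : density = (fun r => r^-1) \o (fun s => dist_bdry G (arc_length_param gamma s))) //.
apply: within_continuous_comp.
  move=> x /set_mem[s sL <-]; apply: inv_continuous.
  have [|t [t01 _ ->]] := arc_length_paramP (s := s); first by move: sL; rewrite /= ?in_itv.
  rewrite gt_eqF // dist_bdry_gt0 //; apply: gamma_in; by exists t.
apply/within_continuous_epsP => s /= sL e e0; exists e => // s' s'L ss'.
move: sL s'L; rewrite !in_itv /= => /arc_length_paramP[t [t01 ts ->]].
move=> /arc_length_paramP[t' [t01' ts' ->]].
apply: le_lt_trans ss'; rewrite -ts -ts'; apply: le_trans (arclen_chord_norm t01 t01').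
have := dist_bdry_lip (gamma t) (gamma t') G_bdry.
have := dist_bdry_lip (gamma t') (gamma t) G_bdry.
rewrite (distrC (gamma t')) => h1 h2; rewrite ler_norml; lra.
Qed.

Lemma density_measurable (D : set R) : measurable D -> D `<=` `[0, L] ->
  measurable_fun D (fun s => (density s)%:E).
Proof.
move=> mD DL; apply/measurable_EFinP; apply: (measurable_funS _ DL) => //.
by apply: measurable_realfun.subspace_continuous_measurable_fun => //; exact: density_cont.
Qed.

Lemma density_ge0 s : 0 <= density s.
Proof. by rewrite invr_ge0 dist_bdry_ge0. Qed.

Lemma arclen_in t : 0 <= t <= 1 -> 0 <= arclen gamma t <= L.
Proof.
move=> /andP[t0 t1]; rewrite arclen_homo // andbT.
by rewrite -(arclen0 gamma_rect); apply: arclen_homo.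
Qed.

Lemma arc_length_param_between t u s : 0 <= t -> t <= u -> u <= 1 ->
  arclen gamma t <= s < arclen gamma u ->
  exists2 v, t <= v <= u & arc_length_param gamma s = gamma v.
Proof.
move=> t0 tu u1 /andP[ts su].
have t01 : 0 <= t <= 1 by rewrite t0 (le_trans tu).
have u01 : 0 <= u <= 1 by rewrite u1 (le_trans t0).
have /andP[a0 aL] := arclen_in t01; have /andP[b0 bL] := arclen_in u01.
have /arc_length_paramP[v [v01 vs ->]] : 0 <= s <= L by apply/andP; split; lra.
have /andP[v0 v1] := v01.
have vu : v <= u.
  rewrite leNgt; apply/negP => /ltW uv.
  by have := arclen_homo gamma_rect (le_trans t0 tu) uv v1; rewrite vs; lra.
(* If [v < t], then arc length is constant on [[v, t]], hence so is [gamma], and [t] can replace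
   [v]. *)
have [tv|vt] := leP t v; first by exists v => //; rewrite tv.
exists t; first by rewrite lexx.
have /andP[_ t1] := t01.
have := arclen_chord gamma_rect v0 (ltW vt) t1; rewrite vs => h.
by apply/esym/eqP; rewrite -subr_eq0 -normr_le0; lra.
Qed.

Lemma integral_density_split t u : 0 <= t -> t <= u -> u <= 1 ->
  (\int[lebesgue_measure]_(s in `[arclen gamma t, L]) (density s)%:E =
   \int[lebesgue_measure]_(s in `[arclen gamma t, arclen gamma u[) (density s)%:E +
   \int[lebesgue_measure]_(s in `[arclen gamma u, L]) (density s)%:E)%E.
Proof.
move=> t0 tu u1.
have t01 : 0 <= t <= 1 by rewrite t0 (le_trans tu).
have u01 : 0 <= u <= 1 by rewrite u1 (le_trans t0).
have /andP[a0 aL] := arclen_in t01; have /andP[b0 bL] := arclen_in u01.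
have ab := arclen_homo gamma_rect t0 tu u1.
rewrite (@itv_bndbnd_setU _ _ _ (BLeft (arclen gamma u))) ?bnd_simp //.
have sub1 : `[arclen gamma t, arclen gamma u[ `<=` `[0, L].
  by move=> s; rewrite /= !in_itv /= => /andP[sa sb]; apply/andP; split; lra.
have sub2 : `[arclen gamma u, L] `<=` `[0, L].
  by move=> s; rewrite /= !in_itv /= => /andP[sa sb]; apply/andP; split; lra.
rewrite ge0_integral_setU //=.
- apply: density_measurable; first exact: measurableU.
  by move=> s [/sub1|/sub2].
- by move=> s _; rewrite lee_fin density_ge0.
- by apply/disj_setPS => s []; rewrite /= !in_itv /= => /andP[_ su] /andP[us _]; lra.
Qed.

Lemma integral_density_bounds (D1 D2 : R) t u : 0 <= t -> t <= u -> u <= 1 ->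
  0 < D1 -> (forall v, t <= v <= u -> D1 <= dist_bdry G (gamma v) <= D2) ->
  (((arclen gamma u - arclen gamma t) / D2)%:E <=
   \int[lebesgue_measure]_(s in `[arclen gamma t, arclen gamma u[) (density s)%:E
   <= ((arclen gamma u - arclen gamma t) / D1)%:E)%E.
Proof.
move=> t0 tu u1 D10 HD.
have D20 : 0 < D2.
  by have := HD t; rewrite lexx tu => /(_ isT)/andP[? ?]; lra.
have ab := arclen_homo gamma_rect t0 tu u1.
have t01 : 0 <= t <= 1 by rewrite t0 (le_trans tu).
have u01 : 0 <= u <= 1 by rewrite u1 (le_trans t0).
have /andP[a0 aL] := arclen_in t01; have /andP[b0 bL] := arclen_in u01.
have cstE (D : R) : (\int[lebesgue_measure]_(s in `[arclen gamma t, arclen gamma u[)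
    (D^-1)%:E = ((arclen gamma u - arclen gamma t) / D)%:E)%E.
  rewrite integral_cst //= lebesgue_measure_itv /= lte_fin.
  case: ltgtP ab => // [ab _|-> _]; first by rewrite -EFinB -EFinM mulrC.
  by rewrite subrr mul0r mule0.
have mdens : measurable_fun `[arclen gamma t, arclen gamma u[ (fun s => (density s)%:E).
  apply: density_measurable => // s; rewrite /= !in_itv /= => /andP[sa sb].
  by apply/andP; split; lra.
have dens s : `[arclen gamma t, arclen gamma u[%classic s -> D2^-1 <= density s <= D1^-1.
  rewrite /= in_itv /= => /(arc_length_param_between t0 tu u1)[v tvu].
  rewrite /density => ->; have /andP[h1 h2] := HD v tvu.
  by rewrite !lef_pV2 ?posrE ?h1 ?h2 // (lt_le_trans D10).
apply/andP; split; rewrite -cstE; apply: ge0_le_integral => //.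
- by move=> s _; rewrite lee_fin invr_ge0 ltW.
- by move=> s /dens/andP[? ?]; rewrite lee_fin.
- by move=> s _; rewrite lee_fin density_ge0.
- by move=> s /dens/andP[? ?]; rewrite lee_fin.
Qed.

(** Follow the curve until it is first at distance [d / 5] from its starting point. The length used
    is at least [d / 5] and the boundary distance stays below [6 * d / 5], whence the cost [1 / 6]
    of a link. *)
Lemma first_link t : 0 <= t <= 1 ->
  link G (gamma t) (gamma 1) \/
  exists t1, [/\ t <= t1 <= 1, link G (gamma t) (gamma t1) &
    ((6^-1)%:E <= \int[lebesgue_measure]_(s in `[arclen gamma t, arclen gamma t1[)
      (density s)%:E)%E].
Proof.
move=> /andP[t0 t1].
have Gt : G (gamma t) by apply: gamma_in; exists t; rewrite //= in_itv /= t0.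
have d0 := dist_bdry_gt0 G_open G_bdry Gt; set d := dist_bdry G (gamma t) in d0.
pose h u := `|gamma u - gamma t|.
have hc : {within `[t, 1], continuous h}.
  apply/within_continuous_epsP => u; rewrite /= in_itv /= => /andP[tu u1] e e0.
  have [|r r0 Hr] := (within_continuous_epsP _ _).1 gamma_cont u _ e e0.
    by rewrite /= in_itv /= u1 (le_trans t0).
  exists r => // v; rewrite /= in_itv /= => /andP[tv v1] uv.
  apply: le_lt_trans (Hr v _ uv); last by rewrite /= in_itv /= v1 (le_trans t0).
  have := ler_dist_dist (gamma u - gamma t) (gamma v - gamma t).
  by rewrite opprB addrA subrK.
have ht : h t = 0 by rewrite /h subrr normr0.
have [h1|h1] := leP (h 1) (d / 5).
  by left; apply: link_close => //; rewrite distrC -/(h 1); lra.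
right; have [||u [/andP[tu u1] hu H]] := first_hitting t1 hc (m := d / 5).
- by rewrite ht divr_ge0 // ltW.
- exact: ltW.
exists u; split; first by rewrite tu.
  by apply: link_close => //; rewrite distrC -/(h u) -/d hu; lra.
have lu := arclen_chord gamma_rect t0 tu u1; rewrite -/(h u) hu in lu.
have d45 : 0 < d * (4 / 5) by rewrite mulr_gt0.
have dv v : t <= v <= u -> d * (4 / 5) <= dist_bdry G (gamma v) <= d * (6 / 5).
  move=> tvu; have := H v tvu.
  have := dist_bdry_lip (gamma v) (gamma t) G_bdry.
  have := dist_bdry_lip (gamma t) (gamma v) G_bdry.
  by rewrite (distrC (gamma t)) -/(h v) -/d => *; apply/andP; split; lra.
have /andP[I _] := integral_density_bounds t0 tu u1 d45 dv.
apply: le_trans I; rewrite lee_fin ler_pdivlMr ?mulr_gt0 //; lra.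
Qed.

Lemma chain_of_integral (n : nat) t : 0 <= t <= 1 ->
  (\int[lebesgue_measure]_(s in `[arclen gamma t, L]) (density s)%:E < (n%:R / 6)%:E)%E ->
  chain G n (gamma t) (gamma 1).
Proof.
elim: n t => [|n IH] t t01.
  rewrite mul0r ltNge integral_ge0 // => s _; rewrite lee_fin; exact: density_ge0.
have /andP[t0 t1] := t01 => I.
have [h|[u [/andP[tu u1] tul Iu]]] := first_link t01.
  by apply: chain_le (chain1 h).
rewrite -add1n; apply: chain_trans (chain1 tul) (IH u _ _); first by rewrite u1 (le_trans t0).
move: I; rewrite (integral_density_split t0 tu u1) => I.
have := le_lt_trans (leeD2r (\int[lebesgue_measure]_(s in `[arclen gamma u, L])
  (density s)%:E)%E Iu) I.
rewrite -lteBrDl // -EFinB => h; apply: (lt_le_trans h); rewrite lee_fin -natr1; lra.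
Qed.

End LineIntegral.

Lemma chain_of_qh_dist (R : realType) (E : completeNormedModType R) (G : set E)
    (n : nat) (x y : E) : open G -> bdry G !=set0 ->
  (qh_dist G x y < (n%:R / 6)%:E)%E -> chain G n x y.
Proof.
move=> Go G0 /ereal_inf_lt[_ [gamma [gc gi g0 g1 gr] <-]] I.
rewrite -g0 -g1; apply: (chain_of_integral Go G0 gc gi gr); first by rewrite lexx ler01.
by rewrite (arclen0 gr).
Qed.

(** * From chains to quasihyperbolic distance *)

Section Polygon.
Context {R : realType}.

Definition clamp (v : R) : R := Num.max 0 (Num.min 1 v).

Lemma clamp_le0 v : v <= 0 -> clamp v = 0.
Proof. by move=> v0; rewrite /clamp; apply/max_idPl; rewrite ge_min v0 orbT. Qed.

Lemma clamp_id v : 0 <= v <= 1 -> clamp v = v.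
Proof. by move=> /andP[v0 v1]; rewrite /clamp (min_idPr v1); apply/max_idPr. Qed.

Lemma clamp_ge1 v : 1 <= v -> clamp v = 1.
Proof. by move=> v1; rewrite /clamp (min_idPl v1); apply/max_idPr; exact: ler01. Qed.

Lemma clamp_bounds u v : u <= v -> clamp u <= clamp v <= clamp u + (v - u).
Proof.
move=> uv; have [u0|u0] := leP u 0; have [v0|v0] := leP v 0;
  have [u1|u1] := leP 1 u; have [v1|v1] := leP 1 v;
  rewrite ?(clamp_le0 u0) ?(clamp_le0 v0) ?(clamp_ge1 u1) ?(clamp_ge1 v1)
   ?(@clamp_id u) ?(@clamp_id v) ?(ltW u0) ?(ltW v0) ?(ltW u1) ?(ltW v1) //; lra.
Qed.

Context {V : normedModType R}.
Implicit Types p : nat -> V.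

(** This is the broken line through [p 0, ..., p n] whose [i]-th edge is traversed for [u] in
    [[i, i + 1]]. Written as a sum of clamped increments, it admits chord and Lipschitz estimates
    term by term, without locating [u]. *)
Definition polygon p (n : nat) (u : R) : V :=
  p 0%N + \sum_(i < n) clamp (u - i%:R) *: (p i.+1 - p i).

Definition polygon_len p (n : nat) (u : R) : R :=
  \sum_(i < n) clamp (u - i%:R) * `|p i.+1 - p i|.

Lemma polygon_lenE p n (i : nat) u : (i < n)%N -> i%:R <= u <= i.+1%:R ->
  polygon_len p n u = \sum_(k < i) `|p k.+1 - p k| + (u - i%:R) * `|p i.+1 - p i|.
Proof.
move=> ni /andP[iu ui]; rewrite /polygon_len.
rewrite -(big_mkord xpredT (fun k => clamp (u - k%:R) * `|p k.+1 - p k|)).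
rewrite (@big_cat_nat _ _ _ i) //=; last exact: ltnW.
congr (_ + _).
  rewrite big_mkord; apply: eq_bigr => k _; rewrite clamp_ge1 ?mul1r //.
  have : k.+1%:R <= i%:R :> R by rewrite ler_nat.
  rewrite -natr1; lra.
rewrite big_ltn // clamp_id; last by rewrite -natr1 in ui; apply/andP; split; lra.
rewrite big_nat big1 ?addr0 // => k /andP[ik _]; rewrite clamp_le0 ?mul0r //.
have : i.+1%:R <= k%:R :> R by rewrite ler_nat.
lra.
Qed.

Lemma polygonE p n (i : nat) u : (i < n)%N -> i%:R <= u <= i.+1%:R ->
  polygon p n u = p i + (u - i%:R) *: (p i.+1 - p i).
Proof.
move=> ni /andP[iu ui]; rewrite /polygon.
rewrite -(big_mkord xpredT (fun k => clamp (u - k%:R) *: (p k.+1 - p k))).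
rewrite (@big_cat_nat _ _ _ i) //=; last exact: ltnW.
rewrite addrA; congr (_ + _).
  rewrite (eq_big_nat _ _ (F2 := fun k => p k.+1 - p k)).
    by rewrite telescope_sumr // addrC subrK.
  move=> k /andP[_ ki]; rewrite clamp_ge1 ?scale1r //.
  have : k.+1%:R <= i%:R :> R by rewrite ler_nat.
  rewrite -natr1; lra.
rewrite big_ltn // clamp_id; last by rewrite -natr1 in ui; apply/andP; split; lra.
rewrite big_nat big1 ?addr0 // => k /andP[ik _]; rewrite clamp_le0 ?scale0r //.
have : i.+1%:R <= k%:R :> R by rewrite ler_nat.
lra.
Qed.

Lemma polygon_node p n i : (i <= n)%N -> polygon p n i%:R = p i.
Proof.
rewrite leq_eqVlt => /predU1P[->|ni]; last first.
  by rewrite (polygonE _ ni) ?lexx ?ler_nat ?leqnSn // subrr scale0r addr0.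
case: n => [|n]; first by rewrite /polygon big_ord0 addr0.
rewrite (@polygonE _ _ n) ?leqnn // ?lexx ?ler_nat ?leqnSn //.
by rewrite -natrB // subSnn scale1r addrC subrK.
Qed.

Lemma polygon_len_node p n i : (i <= n)%N ->
  polygon_len p n i%:R = \sum_(k < i) `|p k.+1 - p k|.
Proof.
rewrite leq_eqVlt => /predU1P[->|ni]; last first.
  by rewrite (polygon_lenE _ ni) ?lexx ?ler_nat ?leqnSn // subrr mul0r addr0.
case: n => [|n]; first by rewrite /polygon_len !big_ord0.
rewrite (@polygon_lenE _ _ n) ?leqnn // ?lexx ?ler_nat ?leqnSn //.
by rewrite -natrB // subSnn mul1r big_ord_recr.
Qed.

Lemma polygon_chord p n u v : u <= v ->
  `|polygon p n v - polygon p n u| <= polygon_len p n v - polygon_len p n u.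
Proof.
move=> uv; rewrite /polygon opprD addrACA subrr add0r -!sumrB.
apply: (le_trans (ler_norm_sum _ _ _)); apply: ler_sum => i _.
rewrite -scalerBl normrZ -mulrBl ger0_norm // subr_ge0.
by have /andP[] := @clamp_bounds (u - i%:R) (v - i%:R) ltac:(lra).
Qed.

Lemma polygon_len_homo p n u v : u <= v -> polygon_len p n u <= polygon_len p n v.
Proof.
by move=> /(polygon_chord p n) h; rewrite -subr_ge0; apply: le_trans h.
Qed.

Lemma polygon_lip p n u v : u <= v ->
  `|polygon p n v - polygon p n u| <= (v - u) * \sum_(i < n) `|p i.+1 - p i|.
Proof.
move=> uv; apply: (le_trans (polygon_chord p n uv)).
rewrite /polygon_len -sumrB mulr_sumr; apply: ler_sum => i _.
rewrite -mulrBl ler_wpM2r //.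
by have /andP[] := @clamp_bounds (u - i%:R) (v - i%:R) ltac:(lra); lra.
Qed.

Definition polygon_path p (n : nat) (t : R) : V := polygon p n (n%:R * t).

Lemma polygon_path_cont p n (A : set R) : {within A, continuous (polygon_path p n)}.
Proof.
apply/within_continuous_epsP => s _ e e0.
set S := \sum_(i < n) `|p i.+1 - p i|.
have S0 : 0 <= S by apply: sumr_ge0.
have nS0 : 0 < n%:R * S + 1 by rewrite ltr_wpDl // mulr_ge0.
have main u v : u <= v -> (v - u) * (n%:R * S + 1) < e ->
    `|polygon_path p n u - polygon_path p n v| < e.
  move=> uv h; rewrite distrC; apply: le_lt_trans h.
  apply: (le_trans (polygon_lip _ _ _)); first by rewrite ler_wpM2l.
  by rewrite -/S; lra.
exists (e / (n%:R * S + 1)); first by rewrite divr_gt0.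
move=> t _; rewrite ltr_pdivlMr //; have [st|/ltW ts] := leP s t.
  by rewrite ler0_norm ?subr_le0 // opprB; exact: main.
by rewrite ger0_norm ?subr_ge0 // distrC; exact: main.
Qed.

Lemma polygon_piece (n : nat) (u : R) : (0 < n)%N -> 0 <= u <= n%:R ->
  exists2 i : nat, (i < n)%N & i%:R <= u <= i.+1%:R.
Proof.
elim: n => // -[|n] IH _ /andP[u0 un]; first by exists 0%N => //; rewrite u0.
have [h|h] := leP u n.+1%:R; last by exists n.+1; rewrite ?(ltW h).
by have [//||i ni iu] := IH; [rewrite u0|exists i => //; exact: ltnW].
Qed.

End Polygon.

Section PolygonLength.
Context {R : realType} {E : completeNormedModType R}.
Implicit Types (G : set E) (p : nat -> E).

Lemma polygon_path_length p n a b : a <= b ->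
  (curve_length (polygon_path p n) a b <=
   (polygon_len p n (n%:R * b) - polygon_len p n (n%:R * a))%:E)%E.
Proof.
move=> ab; apply: (@curve_length_le _ _ _ (fun t => polygon_len p n (n%:R * t))).
by move=> s t _ st _; apply: polygon_chord; rewrite ler_wpM2l.
Qed.

Lemma polygon_near p n (i : nat) (t : R) : (i < n)%N ->
  i%:R <= n%:R * t <= i.+1%:R ->
  `|p i - polygon_path p n t| <= `|p i.+1 - p i|.
Proof.
move=> ni it; rewrite /polygon_path (polygonE _ ni) // opprD addNKr normrN normrZ.
rewrite ler_piMl // ger0_norm; move: it; rewrite -natr1; lra.
Qed.

(** An edge is at most [d / 4] long, with [d] the boundary distance of its first vertex, and the
    boundary distance on it is at least [3 * d / 4]; so it costs at most [1 / 3]. *)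
Lemma qh_dist_chain G n x y : open G -> bdry G !=set0 -> G x -> chain G n x y ->
  (qh_dist G x y <= (n.+1%:R / 3)%:E)%E.
Proof.
(* One trivial link is added so that [m] is positive and [[0, 1]] can be divided into [m] parts even
   when [n = 0]. *)
move=> Go G0 Gx /(chain_le (leqnSn n)); set m := n.+1 => xy.
have [p [p0 pn pl]] := xy.
set gamma := polygon_path p m.
have m0 : 0 < m%:R :> R by rewrite ltr0n.
have gc : {within `[0, 1], continuous gamma} by exact: polygon_path_cont.
have gr : (curve_length gamma 0%R 1%R < +oo)%E.
  by apply: le_lt_trans (polygon_path_length p m ler01) _; rewrite ltry.
have Gp i : (i <= m)%N -> G (p i).
  move=> im; apply: (@chain_in _ _ G i x) => //; exists p; split => // k ki.
  by apply: pl; apply: leq_trans im.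
have node i : (i <= m)%N -> 0 <= (i%:R / m%:R : R) <= 1.
  by move=> im; rewrite divr_ge0 //= ler_pdivrMr // mul1r ler_nat.
have nodeE i : m%:R * (i%:R / m%:R) = i%:R :> R by rewrite mulrC divfK ?gt_eqF.
have gi : gamma @` `[0, 1] `<=` G.
  move=> _ [t + <-]; rewrite /= in_itv /= => /andP[t0 t1].
  have [//||i im it] := @polygon_piece _ m (m%:R * t).
    by rewrite mulr_ge0 //= ler_piMr.
  apply: (ball_dist_bdry Go (Gp i (ltnW im))).
  apply: (le_lt_trans (polygon_near p im it)); have [h _] := pl _ im.
  by have := dist_bdry_gt0 Go G0 (Gp i (ltnW im)); rewrite distrC; move: h; lra.
suff main i : (i <= m)%N ->
  (\int[lebesgue_measure]_(s in `[arclen gamma ((m - i)%:R / m%:R), arclen gamma 1])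
   ((dist_bdry G (arc_length_param gamma s))^-1)%:E <= (i%:R / 3)%:E)%E.
  have := main m (leqnn m); rewrite subnn mul0r (arclen0 gr) => I.
  apply: ge_ereal_inf; eexists; last exact: I.
  exists gamma => //; split => //.
  - by rewrite /gamma /polygon_path mulr0 -p0 -(polygon_node p (leq0n m)).
  - by rewrite /gamma /polygon_path mulr1 -pn -(polygon_node p (leqnn m)).
elim: i => [|i IH] im.
  rewrite subn0 divff ?gt_eqF // set_itv1 integral_set1 mul0r //.
have tu : (m - i.+1)%:R / m%:R <= (m - i)%:R / m%:R :> R.
  by rewrite ler_pM2r ?invr_gt0 // ler_nat; lia.
have /andP[t0 t1] := node (m - i.+1)%N ltac:(lia).
have /andP[u0 u1] := node (m - i)%N ltac:(lia).
rewrite (integral_density_split Go G0 gc gi gr t0 tu u1).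
set k := (m - i.+1)%N in t0 t1 tu *.
have km : (k < m)%N by rewrite /k; lia.
have kE : (m - i)%N = k.+1 by rewrite /k; lia.
rewrite kE in tu u0 u1 IH *.
have dk0 := dist_bdry_gt0 Go G0 (Gp k (ltnW km)).
have [pk _] := pl _ km; rewrite distrC in pk.
have D10 : 0 < dist_bdry G (p k) * (3 / 4) by rewrite mulr_gt0.
have Dv v : k%:R / m%:R <= v <= k.+1%:R / m%:R ->
    dist_bdry G (p k) * (3 / 4) <= dist_bdry G (gamma v) <= dist_bdry G (p k) * (5 / 4).
  rewrite ler_pdivrMr // ler_pdivlMr // mulrC => kv.
  have := polygon_near p km kv.
  have := dist_bdry_lip (p k) (gamma v) G0.
  have := dist_bdry_lip (gamma v) (p k) G0; rewrite (distrC (gamma v)).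
  rewrite -/gamma => h1 h2 h3; apply/andP; split; lra.
have /andP[_ I] := integral_density_bounds Go G0 gc gi gr t0 tu u1 D10 Dv.
have -> : (i.+1%:R / 3 : R) = i%:R / 3 + 1 / 3 by rewrite -(natr1 i) mulrDl.
rewrite EFinD addeC; apply: leeD; first exact: IH (ltnW im).
apply: (le_trans I); rewrite lee_fin ler_pdivrMr //.
suff : arclen gamma (k.+1%:R / m%:R) - arclen gamma (k%:R / m%:R) <= `|p k.+1 - p k| by lra.
have h := curve_length_arclen_le gr t0 tu u1.
have := le_trans h (polygon_path_length p m tu); rewrite lee_fin !nodeE.
rewrite !polygon_len_node ?(ltnW km) // big_ord_recr /=; lra.
Qed.

End PolygonLength.

(** * Shortest chains *)

Section MinimalChains.
Context {R : realType} {E : completeNormedModType R}.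
Implicit Types (G : set E) (p : nat -> E).

Lemma link_between G (p q : E) (s : R) : bdry G !=set0 -> 0 <= s <= 1 -> link G p q ->
  link G p (p + s *: (q - p)) /\ link G (p + s *: (q - p)) q.
Proof.
move=> G0 /andP[s0 s1] [lp lq]; set z := p + s *: (q - p).
have pz : `|p - z| = s * `|p - q|.
  by rewrite /z opprD addNKr normrN normrZ ger0_norm // distrC.
have zq : `|z - q| = (1 - s) * `|p - q|.
  rewrite -normrN opprB (_ : q - z = (1 - s) *: (q - p)).
    by rewrite normrZ ger0_norm ?subr_ge0 // distrC.
  by rewrite /z scalerBl scale1r opprD addrA.
have h1 := dist_bdry_lip p z G0; have h2 := dist_bdry_lip q z G0.
rewrite (distrC q) in h2; have := normr_ge0 (p - q).
rewrite /link pz zq in h1 h2 *; split; split; nra.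
Qed.

Lemma polygon_path_in G p n : open G -> bdry G !=set0 -> G (p 0%N) ->
  (forall i, (i < n)%N -> link G (p i) (p i.+1)) -> (0 < n)%N ->
  polygon_path p n @` `[0, 1] `<=` G.
Proof.
move=> Go G0 Gp0 pl n0 _ [t + <-]; rewrite /= in_itv /= => /andP[t0 t1].
have [//||i im it] := @polygon_piece _ n (n%:R * t).
  by rewrite mulr_ge0 //= ler_piMr.
have Gpi : G (p i).
  by apply: (@chain_in _ _ G i (p 0%N)) => //; exists p; split => // k ki; apply: pl; nat_lia.
apply: (ball_dist_bdry Go Gpi); apply: (le_lt_trans (polygon_near p im it)).
have [h _] := pl _ im.
by have := dist_bdry_gt0 Go G0 Gpi; rewrite distrC; move: h; lra.
Qed.

(* A polygonal path through a shortest chain is an arc: if two of its segments met,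
   going through the meeting point would give a shorter chain. *)
Lemma minimal_chain_injective G p n : bdry G !=set0 -> (0 < n)%N ->
  (forall i, (i < n)%N -> link G (p i) (p i.+1)) ->
  (forall i j k, (i < j <= n)%N -> chain G k (p i) (p j) -> (j - i <= k)%N) ->
  {in `[0, 1] &, injective (polygon_path p n)}.
Proof.
move=> G0 n0 pl pmin.
have n0' : 0 < n%:R :> R by rewrite ltr0n.
suff main (u v : R) : 0 <= u -> u < v -> v <= n%:R -> polygon p n u <> polygon p n v.
  move=> s t; rewrite !in_itv /= => /andP[s0 s1] /andP[t0 t1] st.
  have [lt|lt|//] := ltgtP s t; exfalso.
    by apply: (main _ _ _ _ _ st); rewrite ?mulr_ge0 ?ltr_pM2l ?ler_piMr.
  by apply: (main _ _ _ _ _ (esym st)); rewrite ?mulr_ge0 ?ltr_pM2l ?ler_piMr.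
move=> u0 uv vn.
(* The edge of [u] is half-open on the right and that of [v] on the left, so a vertex shared by
   consecutive edges is never counted as a meeting point. *)
have [i [im iu ui]] : exists i : nat, [/\ (i < n)%N, i%:R <= u & u < i.+1%:R].
  have [//||i im /andP[iu ui]] := @polygon_piece _ n u; first by apply/andP; split; lra.
  move: ui; rewrite le_eqVlt => /predU1P[ui|]; last by exists i.
  have im' : (i.+1 < n)%N by rewrite -(ltr_nat R) -ui; lra.
  by exists i.+1; split; rewrite ?ui ?ltr_nat.
have [j [jm jv vj]] : exists j : nat, [/\ (j < n)%N, j%:R < v & v <= j.+1%:R].
  have [//||j jm /andP[jv vj]] := @polygon_piece _ n v; first by apply/andP; split; lra.
  move: jv; rewrite le_eqVlt => /predU1P[jv|]; last by exists j.
  case: j jm jv vj => [|j] jm jv vj; first by move: jv uv; lra.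
  by exists j; split; rewrite -?jv ?ltr_nat // ltnW.
have ij : (i <= j)%N by rewrite -ltnS -(ltr_nat R); lra.
rewrite (polygonE _ im) ?iu ?ltW // (polygonE _ jm) ?vj ?(ltW jv) //.
set s := u - i%:R; set r := v - j%:R => meet.
have s01 : 0 <= s <= 1 by move: ui; rewrite /s -natr1 => ?; apply/andP; split; lra.
have r01 : 0 <= r <= 1 by move: vj; rewrite /r -natr1 => ?; apply/andP; split; lra.
have [_ l1] := link_between G0 r01 (pl _ jm).
have [l2 _] := link_between G0 s01 (pl _ im).
have [ijE|[ijE|ijE]] : j = i \/ j = i.+1 \/ (i.+2 <= j)%N by nat_lia.
- move: meet; rewrite /r ijE => /addrI/eqP; rewrite -subr_eq0 -scalerBl scaler_eq0.
  rewrite subr_eq0 => /orP[/eqP|]; first by rewrite /s; move: uv; lra.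
  rewrite subr_eq0 => /eqP pE; have := @pmin i i.+1 0%N ltac:(nat_lia).
  rewrite pE => /(_ (chainxx _ _ _)); nat_lia.
- have s1 : 0 < 1 - s by move: ui; rewrite /s -natr1; lra.
  have r0 : 0 < r by rewrite /r subr_gt0.
  suff l : link G (p i) (p i.+2).
    by have := @pmin i i.+2 1%N ltac:(nat_lia) (chain1 l); nat_lia.
  rewrite ijE in meet jm.
  have back : r *: (p i.+2 - p i.+1) = (1 - s) *: (p i - p i.+1).
    apply: (addrI (p i.+1)); rewrite -meet [(1 - s) *: _]scalerBl scale1r addrA.
    rewrite [p i.+1 + (p i - _)]addrC subrK.
    by rewrite -scalerN opprB.
  have [h|/ltW h] := leP (1 - s) r.
    have e : p i.+2 = p i.+1 + ((1 - s) / r) *: (p i - p i.+1).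
      by rewrite mulrC -scalerA -back scalerA mulVf ?gt_eqF // scale1r addrC subrK.
    have k01 : 0 <= (1 - s) / r <= 1 by rewrite divr_ge0 ?(ltW s1) ?(ltW r0) // ler_pdivrMr // mul1r.
    by rewrite e; apply: link_sym; case: (link_between G0 k01 (link_sym (pl _ im))).
  have e : p i = p i.+1 + (r / (1 - s)) *: (p i.+2 - p i.+1).
    by rewrite mulrC -scalerA back scalerA mulVf ?gt_eqF // scale1r addrC subrK.
  have k01 : 0 <= r / (1 - s) <= 1 by rewrite divr_ge0 ?(ltW s1) ?(ltW r0) // ler_pdivrMr // mul1r.
  by rewrite [p i]e; case: (link_between G0 k01 (pl _ jm)).
- rewrite -meet in l1; have := @pmin i j.+1 2%N ltac:(nat_lia).
  by move=> /(_ (chain_trans (chain1 l2) (chain1 l1))); nat_lia.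
Qed.

End MinimalChains.

Section Uniformity.
Context {R : realType}.

Lemma le_exp2n (a : R) : exists L : nat, a <= 2 ^+ L.
Proof.
have [a0|/ltW a0] := leP a 0; first by exists 0%N; rewrite expr0; lra.
exists (Num.bound a); apply: (@le_trans _ _ (Num.bound a)%:R).
  by apply/ltW; have := archi_boundP a0.
by rewrite -natrX ler_nat ltnW // ltn_expl.
Qed.

(* The discrete counterpart of [k_G <= C log (1 + r_G) + C]: [L] bounds the binary
   logarithm of the relative distance. *)
Definition log_chain (K : nat) (E : completeNormedModType R) (G : set E) :=
  forall x y (L : nat), G x -> G y ->
    `|x - y| <= 2 ^+ L * dist_bdry G x -> `|x - y| <= 2 ^+ L * dist_bdry G y ->
    chain G (K * L.+1) x y.

Section MinimalLogChain.
Variables (K : nat) (NN : nat -> nat) (B : R) (E : completeNormedModType R) (G : set E).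
Hypothesis HNN : forall A n : nat,
  (forall L : nat, (2 ^ A * n <= 2 ^ L)%N -> (n <= K * L.+1)%N) -> (n <= NN A)%N.
Hypothesis B0 : 0 <= B.
Hypothesis HB : forall d m, growth_seq NN d m ->
  forall i, (i <= m)%N -> \sum_(j < i) d j <= B * d i.
Hypothesis Go : open G.
Hypothesis G0 : bdry G !=set0.
Hypothesis HK : log_chain K G.
Variables (p : nat -> E) (n m : nat).
Hypothesis Gp : forall i, (i <= n)%N -> G (p i).
Hypothesis pl : forall i, (i < n)%N -> link G (p i) (p i.+1).
Hypothesis pmin : forall i j k, (i < j <= n)%N -> chain G k (p i) (p j) -> (j - i <= k)%N.
Hypothesis mn : (m <= n)%N.
Hypothesis pmax : forall i, (i <= n)%N -> dist_bdry G (p i) <= dist_bdry G (p m).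
Let d i := dist_bdry G (p i).
Let step i := `|p i.+1 - p i|.

Lemma step_le i : (i < n)%N -> 4 * step i <= d i /\ 4 * step i <= d i.+1.
Proof. by move=> /pl[]; rewrite distrC. Qed.

Lemma chain_pos i : (i <= n)%N -> 0 < d i.
Proof. by move=> /Gp; exact: dist_bdry_gt0. Qed.

Lemma chain_ratio i : (i < n)%N -> d i <= 2 * d i.+1 /\ d i.+1 <= 2 * d i.
Proof.
move=> im; have h1 := link_dist_bdry G0 (pl im).
have h2 := link_dist_bdry G0 (link_sym (pl im)).
have := chain_pos (ltnW im); have := chain_pos im; rewrite /d; split; lra.
Qed.

Lemma chain_displacement i j : (i <= j <= n)%N ->
  `|p i - p j| <= \sum_(i <= k < j) step k.
Proof.
move=> /andP[ij jn]; rewrite distrC -telescope_sumr //; exact: ler_norm_sum.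
Qed.

(** A stretch of [j - i] links has displacement at most [2 ^+ A * (j - i)] times the boundary
    distance at either end. The logarithmic bound then gives a chain that the minimal one cannot
    exceed, so [j - i] is at most logarithmic in itself and hence bounded. *)
Lemma minimal_chain_long A i j : (i < j <= n)%N ->
  (forall k, (i <= k <= j)%N -> d k <= 2 ^+ A * d i /\ d k <= 2 ^+ A * d j) ->
  (j - i <= NN A)%N.
Proof.
move=> ijn H; apply: HNN => L hL; apply: (pmin ijn).
have ub D : 0 <= D -> (forall k, (i <= k <= j)%N -> d k <= 2 ^+ A * D) ->
    `|p i - p j| <= 2 ^+ L * D.
  move=> D0 HD; apply: (le_trans (chain_displacement _)); first nat_lia.
  apply: (@le_trans _ _ (\sum_(i <= k < j) 2 ^+ A * D)).
    rewrite !big_nat; apply: ler_sum => k /andP[ik kj].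
    apply: le_trans (HD k ltac:(nat_lia)).
    have [h _] := @step_le k ltac:(nat_lia); have := normr_ge0 (p k.+1 - p k).
    by rewrite /step in h *; lra.
  rewrite sumr_const_nat -[_ *+ (j - i)]mulr_natr mulrAC ler_wpM2r //.
  by rewrite -!natrX -natrM ler_nat.
apply: HK; [apply: Gp; nat_lia|apply: Gp; nat_lia| |].
  by apply: ub => [|k /H[]//]; apply/ltW/chain_pos; nat_lia.
by apply: ub => [|k /H[]//]; apply/ltW/chain_pos; nat_lia.
Qed.

Lemma sum_left i : (i <= m)%N -> \sum_(j < i) d j <= B * d i.
Proof.
apply: HB; split.
- by move=> k km; apply: chain_pos; nat_lia.
- by move=> k km; apply: chain_ratio; nat_lia.
- by move=> k km; apply: pmax; nat_lia.
- by move=> A a b abm; apply: minimal_chain_long; nat_lia.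
Qed.

Lemma sum_right i : (m <= i <= n)%N -> \sum_(i <= j < n) d j.+1 <= B * d i.
Proof.
move=> /andP[mi i_n].
(* Read backwards from [n], the chain is again a growth sequence with its maximum at the end. *)
have gs : growth_seq NN (fun k => d (n - k)%N) (n - m).
  split.
  - by move=> k km; apply: chain_pos; nat_lia.
  - move=> k km; have := @chain_ratio (n - k.+1)%N ltac:(nat_lia).
    by have -> : ((n - k.+1).+1 = n - k)%N; [nat_lia|move=> []].
  - move=> k km; have -> : (n - (n - m) = m)%N by nat_lia.
    by apply: pmax; nat_lia.
  - move=> A a b abm H; have -> : (b - a = (n - a) - (n - b))%N by nat_lia.
    apply: minimal_chain_long; first nat_lia.
    move=> k kk; have := H (n - k)%N ltac:(nat_lia).
    by have -> : (n - (n - k) = k)%N; [nat_lia|move=> []].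
have := HB gs (_ : n - i <= n - m)%N.
have -> : (n - (n - i) = i)%N by nat_lia.
rewrite big_rev_mkord => /(_ ltac:(nat_lia)); apply: le_trans; rewrite le_eqVlt; apply/orP; left.
apply/eqP/eq_bigr => j _; congr d; have := ltn_ord j; nat_lia.
Qed.

Lemma steps_left i : (i <= m)%N -> \sum_(j < i) step j <= B * d i.
Proof.
move=> im; apply: le_trans (sum_left im); apply: ler_sum => j _.
have [h _] := @step_le j ltac:(have := ltn_ord j; nat_lia).
by have := normr_ge0 (p j.+1 - p j); rewrite /step in h *; lra.
Qed.

Lemma steps_right i : (m <= i <= n)%N -> \sum_(i <= j < n) step j <= B * d i.
Proof.
move=> im; apply: le_trans (sum_right im); rewrite !big_nat; apply: ler_sum => j jn.
have [_ h] := @step_le j ltac:(nat_lia).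
by have := normr_ge0 (p j.+1 - p j); rewrite /step in h *; lra.
Qed.

(** If the maximal boundary distance is at most [10 * rho], the two geometric sums suffice.
    Otherwise cut at the first and last index where it reaches [10 * rho]. Since [1 < n], the
    endpoints are not linked and have boundary distance below [5 * rho], so both cuts are interior
    and the value there is at most [20 * rho]. The cut points are [(40 * B + 1) * rho] close, so by
    minimality at most [N3] links lie between them. *)
Lemma total_steps (L0 : nat) : (1 < n)%N -> 40 * B + 1 <= 10 * 2 ^+ L0 ->
  \sum_(j < n) step j <=
    (40 * B + 20 * ((K * L0.+1)%:R * 2 ^+ (K * L0.+1))) * `|p 0%N - p n|.
Proof.
move=> n1 hL0; set rho := `|p 0%N - p n|; set N3 := (K * L0.+1)%N.
have rho0 : 0 <= rho by exact: normr_ge0.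
have c0 : 0 <= N3%:R * 2 ^+ N3 :> R by rewrite mulr_ge0 ?exprn_ge0.
have nolink : ~ link G (p 0%N) (p n).
  by move=> l; have := @pmin 0%N n 1%N ltac:(nat_lia) (chain1 l); nat_lia.
have d0 : d 0%N < 5 * rho.
  by rewrite ltNge; apply/negP => h; apply: nolink; apply: link_close.
have dn : d n < 5 * rho.
  rewrite ltNge; apply/negP => h; apply: nolink; apply/link_sym/link_close => //.
  by rewrite distrC.
have cut i : (i <= n)%N -> \sum_(j < n) step j = \sum_(j < i) step j + \sum_(i <= j < n) step j.
  by move=> i_n; rewrite -!(big_mkord xpredT step) -big_cat_nat.
have [dm|dm] := leP (d m) (10 * rho).
  rewrite (cut m mn); have h1 := steps_left (leqnn m).
  have h2 := @steps_right m ltac:(nat_lia).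
  have h3 : B * d m <= B * (10 * rho) by rewrite ler_wpM2l.
  by have := mulr_ge0 c0 rho0; have := mulr_ge0 B0 rho0; lra.
have exI : exists i, (i <= m)%N && (10 * rho <= d i) by exists m; rewrite leqnn ltW.
have exJ : exists j, (m <= j <= n)%N && (10 * rho <= d j) by exists m; rewrite leqnn mn ltW.
have ubJ j : (m <= j <= n)%N && (10 * rho <= d j) -> (j <= n)%N by move=> /andP[/andP[]].
case: (ex_minnP exI) => i /andP[im di] mini.
case: (ex_maxnP exJ ubJ) => j /andP[/andP[mj jn] dj] maxj.
have i0 : (0 < i)%N by rewrite lt0n; apply/eqP => E0; move: di; rewrite E0; lra.
have jltn : (j < n)%N.
  by rewrite ltn_neqAle jn andbT; apply/eqP => E0; move: dj; rewrite E0; lra.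
have di2 : d i <= 20 * rho.
  have [_ h] := @chain_ratio i.-1 ltac:(nat_lia); rewrite prednK // in h.
  suff : d i.-1 < 10 * rho by lra.
  by rewrite ltNge; apply/negP => h'; have := mini i.-1; rewrite h' andbT; nat_lia.
have dj2 : d j <= 20 * rho.
  have [h _] := @chain_ratio j ltac:(nat_lia).
  suff : d j.+1 < 10 * rho by lra.
  by rewrite ltNge; apply/negP => h'; have := maxj j.+1; rewrite h' andbT; nat_lia.
have hl : \sum_(k < i) step k <= B * (20 * rho).
  by apply: (le_trans (steps_left im)); rewrite ler_wpM2l.
have hr : \sum_(j <= k < n) step k <= B * (20 * rho).
  by apply: (le_trans (@steps_right j ltac:(nat_lia))); rewrite ler_wpM2l.
have mid : \sum_(i <= k < j) step k <= 20 * (N3%:R * 2 ^+ N3) * rho.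
  have [->|ij] := eqVneq i j; first by rewrite big_geq // !mulr_ge0.
  have pij : `|p i - p j| <= (40 * B + 1) * rho.
    have h1 := @chain_displacement 0%N i ltac:(nat_lia); rewrite big_mkord in h1.
    have h2 := @chain_displacement j n ltac:(nat_lia).
    have := ler_distD (p 0%N) (p i) (p j); have := ler_distD (p n) (p 0%N) (p j).
    by rewrite (distrC (p i) (p 0%N)) (distrC (p n) (p j)) -/rho; lra.
  have len : (j - i <= N3)%N.
    apply: (@pmin i j); first nat_lia.
    have key e : 10 * rho <= e -> `|p i - p j| <= 2 ^+ L0 * e.
      move=> he; apply: (le_trans pij).
      apply: (@le_trans _ _ (10 * 2 ^+ L0 * rho)); first by rewrite ler_wpM2r.
      by rewrite mulrAC mulrC ler_wpM2l ?exprn_ge0.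
    by apply: HK; [apply: Gp; nat_lia|apply: Gp; nat_lia|exact: key|exact: key].
  apply: (@le_trans _ _ (\sum_(i <= k < j) 2 ^+ N3 * (20 * rho))).
    rewrite !big_nat; apply: ler_sum => k /andP[ik kj].
    have [h _] := @step_le k ltac:(nat_lia).
    have hc : chain G N3 (p k) (p i).
      apply: (@chain_le _ _ _ (k - i)); first nat_lia.
      apply: chain_sym; exists (fun l => p (i + l)%N); split; rewrite ?addn0 ?subnKC //.
      by move=> l lk; rewrite addnS; apply: pl; nat_lia.
    have h2 := chain_dist_bdry G0 hc.
    have h3 : 2 ^+ N3 * d i <= 2 ^+ N3 * (20 * rho) by rewrite ler_wpM2l ?exprn_ge0.
    have := normr_ge0 (p k.+1 - p k); rewrite /step in h *; rewrite /d in h h3; lra.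
  rewrite sumr_const_nat -[_ *+ (j - i)]mulr_natr.
  have : (j - i)%:R <= N3%:R :> R by rewrite ler_nat.
  have e0 : 0 <= 2 ^+ N3 * (20 * rho) by rewrite mulr_ge0 ?exprn_ge0 // mulr_ge0.
  move=> /(ler_wpM2l e0); lra.
rewrite (cut i) ?(leq_trans im) // (@big_cat_nat _ _ _ j) //=; last nat_lia.
lra.
Qed.

End MinimalLogChain.

(* The discrete version of the theorem of Gehring and Osgood. *)
Lemma uniform_of_log_chain (K : nat) : exists2 c1 : R, 1 <= c1 &
  forall (E : completeNormedModType R) (G : set E),
    open G -> bdry G !=set0 -> log_chain K G -> uniform_domain c1 G.
Proof.
have /choice[NN HNN] : forall A : nat, exists N, forall n : nat,
    (forall L : nat, (2 ^ A * n <= 2 ^ L)%N -> (n <= K * L.+1)%N) -> (n <= N)%N.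
  by move=> A; exact: linear_exp_bound.
have [B B0 HB] := @growth_sum R NN.
have [L0 hL0'] := le_exp2n (40 * B + 1).
have hL0 : 40 * B + 1 <= 10 * 2 ^+ L0 by have := @exprn_ge0 R L0 2; lra.
set c0 := 40 * B + 20 * ((K * L0.+1)%:R * 2 ^+ (K * L0.+1)).
have c00 : 0 <= 20 * ((K * L0.+1)%:R * 2 ^+ (K * L0.+1)) :> R.
  by rewrite !mulr_ge0 // exprn_ge0.
(* The summand 1 makes the constant at least 1 and covers a chain with a single link, to which
   [total_steps] does not apply. *)
exists (c0 + 1); first by rewrite /c0; lra.
move=> E G Go G0 HK x y Gx Gy xy.
have dx0 := dist_bdry_gt0 Go G0 Gx; have dy0 := dist_bdry_gt0 Go G0 Gy.
have exn : exists n, `[< chain G n x y >].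
  have [L1 h1] := le_exp2n (`|x - y| / dist_bdry G x).
  have [L2 h2] := le_exp2n (`|x - y| / dist_bdry G y).
  exists (K * (L1 + L2).+1)%N; apply/asboolP; apply: HK => //.
    by rewrite -ler_pdivrMr // (le_trans h1) // ler_weXn2l ?ler1n // leq_addr.
  by rewrite -ler_pdivrMr // (le_trans h2) // ler_weXn2l ?ler1n // leq_addl.
case: (ex_minnP exn) => n /asboolP[p [p0 pn pl]] nmin.
have n0 : (0 < n)%N.
  by rewrite lt0n; apply/eqP => E0; move: xy; rewrite -p0 -pn E0 eqxx.
have Gp i : (i <= n)%N -> G (p i).
  move=> im; apply: (@chain_in _ _ G i x) => //; exists p; split => // k ki.
  by apply: pl; apply: leq_trans im.
have pmin i j k : (i < j <= n)%N -> chain G k (p i) (p j) -> (j - i <= k)%N.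
  move=> ijn h; suff : (n <= i + k + (n - j))%N by nat_lia.
  apply: nmin; apply/asboolP; apply: (chain_trans (chain_trans _ h)).
    by exists p; split => // l li; apply: pl; nat_lia.
  exists (fun l => p (j + l)%N); split; rewrite ?addn0 ?subnKC //; first nat_lia.
  by move=> l lk; rewrite addnS; apply: pl; nat_lia.
have [m mn pmax] : exists2 m, (m <= n)%N &
    forall i, (i <= n)%N -> dist_bdry G (p i) <= dist_bdry G (p m).
  case: (@arg_maxP _ _ _ (@ord0 n) xpredT (fun i => dist_bdry G (p i))) => // i _ H.
  exists i; first by rewrite -ltnS.
  by move=> k kn; exact: (H (Ordinal (kn : (k < n.+1)%N))).
have total : \sum_(j < n) `|p j.+1 - p j| <= (c0 + 1) * `|x - y|.
  have [n1|n1] := ltnP 1 n.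
    have := total_steps HNN B0 HB Go G0 HK Gp pl pmin mn pmax n1 hL0.
    by rewrite p0 pn -/c0; have := normr_ge0 (x - y); lra.
  have n1' : n = 1%N by nat_lia.
  rewrite n1' big_ord_recl big_ord0 addr0 /= p0 -[in p 1%N]n1' pn distrC.
  by rewrite ler_peMl // /c0; lra.
pose gamma := polygon_path p n.
have n0' : 0 < n%:R :> R by rewrite ltr0n.
have len a b : a <= b -> 0 <= a -> b <= 1 -> (curve_length gamma a b <=
    (polygon_len p n (n%:R * b) - polygon_len p n (n%:R * a))%:E)%E.
  by move=> ab _ _; exact: polygon_path_length.
have len0 : polygon_len p n 0 = 0.
  by have := polygon_len_node p (leq0n n); rewrite big_ord0.
have len1 : polygon_len p n n%:R = \sum_(j < n) `|p j.+1 - p j|.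
  exact: polygon_len_node.
exists gamma; split.
- split.
  + exact: polygon_path_cont.
  + exact: (minimal_chain_injective G0 n0 pl pmin).
  + by apply: polygon_path_in => //; rewrite p0.
  + by rewrite /gamma /polygon_path mulr0 -p0 -(polygon_node p (leq0n n)).
  + by rewrite /gamma /polygon_path mulr1 -pn -(polygon_node p (leqnn n)).
- apply: (le_trans (len _ _ ler01 _ _)) => //.
  by rewrite lee_fin mulr0 mulr1 len0 len1 subr0.
- move=> t /andP[t0 t1].
  have [//||i im it] := @polygon_piece _ n (n%:R * t).
    by rewrite mulr_ge0 //= ler_piMr.
  have near := polygon_near p im it.
  have [h1 h2] := pl _ im; rewrite distrC in h1 h2.
  have di := chain_pos Go G0 Gp (ltnW im).
  have dg : dist_bdry G (p i) * 3 <= 4 * dist_bdry G (gamma t).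
    by have := dist_bdry_lip (p i) (gamma t) G0; rewrite /gamma in near *; lra.
  have dg1 : dist_bdry G (p i.+1) * 3 <= 5 * dist_bdry G (gamma t).
    by have := link_dist_bdry G0 (link_sym (pl _ im)); lra.
  have dg0 : 0 <= dist_bdry G (gamma t) := dist_bdry_ge0 _ _.
  have fin : B * (2 * dist_bdry G (gamma t)) <= (c0 + 1) * dist_bdry G (gamma t).
    by rewrite mulrA ler_wpM2r // /c0; lra.
  (* The index [m] of maximal boundary distance divides the curve: an edge before it is paid for by
     the steps on its left, an edge after it by those on its right. *)
  rewrite ge_min; have [im'|im'] := leqP i.+1 m.
    apply/orP; left; apply: (le_trans (len _ _ t0 _ _)) => //.
    rewrite lee_fin mulr0 len0 subr0; apply: le_trans fin.
    have /andP[_ it2] := it.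
    apply: (le_trans (polygon_len_homo p n it2)); rewrite polygon_len_node //.
    apply: (le_trans (steps_left HNN HB Go G0 HK Gp pl pmin mn pmax im')).
    by rewrite ler_wpM2l //; lra.
  apply/orP; right; apply: (le_trans (len _ _ t1 _ _)) => //.
  rewrite lee_fin mulr1 len1; apply: le_trans fin.
  have /andP[it1 _] := it.
  have := polygon_len_homo p n it1; rewrite polygon_len_node ?(ltnW im) // => h3.
  have h4 := @steps_right K NN B E G HNN HB Go G0 HK p n m Gp pl pmin mn pmax i ltac:(nat_lia).
  apply: (@le_trans _ _ (B * dist_bdry G (p i))); last by rewrite ler_wpM2l //; lra.
  apply: le_trans h4; rewrite -(big_mkord xpredT (fun j => `|p j.+1 - p j|)).
  rewrite (@big_cat_nat _ _ _ i) //= ?(ltnW im) // big_mkord; lra.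
Qed.

End Uniformity.

(** * Domains with bounded boundary *)

Section Exterior.
Context {R : realType} {E : completeNormedModType R}.
Implicit Types (G : set E) (x y z a v w : E).

Lemma dim_ge2_neq0 : dim_ge2 E -> exists u : E, u != 0.
Proof.
move=> [u [v uv]]; exists u; apply/eqP => u0.
have [] := uv 1 0; first by rewrite u0 scaler0 scale0r addr0.
by move=> /eqP; rewrite oner_eq0.
Qed.

(** This is a unit vector Birkhoff-James orthogonal to [w]: subtract from some [u] outside the line
    of [w] a nearest point of that line, and normalize. *)
Lemma transversal_unit w : dim_ge2 E ->
  exists2 v : E, `|v| = 1 & forall s t : R, `|t| <= `|s *: w + t *: v|.
Proof.
move=> dim2; have [w0|w0] := eqVneq w 0.
  have [u u0] := dim_ge2_neq0 dim2; have nu : 0 < `|u| by rewrite normr_gt0.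
  exists (`|u|^-1 *: u); first by rewrite normrZ gtr0_norm ?invr_gt0 // mulVf ?gt_eqF.
  move=> s t; rewrite w0 scaler0 add0r scalerA normrZ normrM.
  by rewrite (gtr0_norm (_ : 0 < `|u|^-1)) ?invr_gt0 // mulfVK ?gt_eqF.
have [u uw] : exists u, forall s : R, u != s *: w.
  apply: contrapT => /forallNP H; case: dim2 => u [v uv].
  have proportional z : exists s : R, z = s *: w.
    apply: contrapT => /forallNP Hz; apply: (H z) => s; apply/eqP; exact: Hz.
  have [s us] := proportional u; have [t vt] := proportional v.
  have [] := uv t (- s).
    by rewrite us vt !scalerA mulNr -scalerDl mulrC subrr scale0r.
  move=> t0 /eqP; rewrite oppr_eq0 => /eqP s0.
  have [] := uv 1 0; first by rewrite us s0 !scale0r scaler0 addr0.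
  by move=> /eqP; rewrite oner_eq0.
(* For [|s| > T] the point [s *: w] is farther from [u] than 0 is, so the minimum over the compact
   interval [[- T, T]] is global. *)
pose h (s : R) := `|u - s *: w|; pose T := 2 * `|u| / `|w|.
have nw : 0 < `|w| by rewrite normr_gt0.
have T0 : 0 <= T by rewrite divr_ge0 // mulr_ge0.
have [||s0 _ hs0] := @EVT_min R h (- T) T; first lra.
  apply/within_continuous_epsP => s _ e e0; exists (e / `|w|); first by rewrite divr_gt0.
  move=> t _; rewrite ltr_pdivlMr // => st; apply: le_lt_trans st.
  apply: (le_trans (ler_dist_dist _ _)).
  by rewrite opprD opprK addrACA subrr add0r addrC -scalerBl normrZ distrC.
have min s : h s0 <= h s.
  have [sT|] := boolP (s \in `[- T, T]); first exact: hs0.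
  rewrite in_itv /= -ler_norml -ltNge => sT.
  have h0 : h s0 <= h 0 by apply: hs0; rewrite in_itv /=; lra.
  apply: (le_trans h0); rewrite /h scale0r subr0.
  have : 2 * `|u| < `|s| * `|w| by rewrite -ltr_pdivrMr.
  rewrite -normrZ distrC; have := ler_dist_dist (s *: w) u.
  have := ler_norm (`|s *: w| - `|u|); lra.
set v := u - s0 *: w; have v0 : 0 < `|v| by rewrite normr_gt0 subr_eq0.
exists (`|v|^-1 *: v); first by rewrite normrZ gtr0_norm ?invr_gt0 // mulVf ?gt_eqF.
move=> s t; have [->|t0] := eqVneq t 0; first by rewrite normr0.
have := min (s0 - s / (t / `|v|)); rewrite /h -/v.
rewrite scalerBl opprB addrA addrAC -/v => h1.
have -> : s *: w + t *: (`|v|^-1 *: v) = (t / `|v|) *: (v + (s / (t / `|v|)) *: w).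
  rewrite [(t / _) *: (_ + _)]scalerDr !scalerA addrC; congr (_ + _ *: _).
  by rewrite mulrC divfK // mulf_neq0 // invr_eq0 gt_eqF.
rewrite normrZ normrM normfV (gtr0_norm v0).
by rewrite -mulrA ler_peMr // mulrC ler_pdivlMr // mul1r.
Qed.

(** Moving towards [a], each halving of the parameter covers at most [s * |v|] where the boundary
    distance is at least half of that, and so takes 8 links. *)
Lemma chain_halving G a v (s0 : R) : 0 < s0 ->
  (forall s, s0 <= s <= 1 -> s * `|v| / 2 <= dist_bdry G (a + s *: v)) ->
  forall (l : nat) s, s0 <= s <= 1 -> 1 <= 2 ^+ l * s ->
  chain G (8 * l) (a + v) (a + s *: v).
Proof.
move=> s00 Hd; elim=> [|l IH] s /andP[s0s s1] hs.
  have -> : s = 1 by move: hs; rewrite expr0; lra.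
  by rewrite scale1r; exact: chainxx.
set s' := Num.min 1 (2 * s).
have s'1 : s' <= 1 by rewrite ge_min lexx.
have s'2 : s' <= 2 * s by rewrite ge_min lexx orbT.
have ss' : s <= s' by rewrite le_min s1 /=; lra.
have hs' : 1 <= 2 ^+ l * s'.
  rewrite /s' minEle; case: ifP => _; first by rewrite mulr1 exprn_ege1 // ler1n.
  by rewrite mulrA -exprSr.
have -> : (8 * l.+1 = 8 * l + 8)%N by lia.
apply: (@chain_trans _ _ _ _ _ _ (a + s' *: v)); first by apply: IH => //; lra.
apply: (@chain_segment _ _ _ _ _ _ (s * `|v| / 2)) => // [t /andP[t0 t1]|].
  rewrite opprD addrACA subrr add0r -scalerBl scalerA -addrA -scalerDl.
  set r := s' + _; have r1 : r <= s' by rewrite /r; nra.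
  have r0 : s <= r by rewrite /r; nra.
  apply: le_trans (Hd r _); last by apply/andP; split; lra.
  by rewrite ler_pM2r // ler_wpM2r.
rewrite dist_line ler0_norm; last lra.
by have := normr_ge0 v; nra.
Qed.

Lemma dist_bdry_ge G a x (r : R) : bdry G !=set0 ->
  (forall b, bdry G b -> `|b - a| <= r) -> `|x - a| - r <= dist_bdry G x.
Proof.
move=> G0 Gr; rewrite leNgt; apply/negP => lt.
have [|b Gb] := dist_bdry_approx x G0 (e := `|x - a| - r - dist_bdry G x); first lra.
by have := Gr b Gb; have := ler_distD b x a; lra.
Qed.

(* The detour [x], [x + p], [y + p], [y] stays away from [a] for one of the two signs of
   [p], because [p] is transversal to [x - a]. *)
Lemma exterior_sphere_chain G a x y (r : R) : dim_ge2 E -> bdry G !=set0 ->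
  (forall b, bdry G b -> `|b - a| <= r) -> 0 < `|x - a| -> 10 * r <= `|x - a| ->
  `|y - a| = `|x - a| -> chain G 360 x y.
Proof.
move=> dim2 G0 Gr; set m := `|x - a|; set w := x - a; set u := y - a => m0 rm um.
have Gd z (e : R) : e * m <= `|z - a| -> (e - 10^-1) * m <= dist_bdry G z.
  by move=> ez; have := dist_bdry_ge z G0 Gr; lra.
have [v v1 Hv] := transversal_unit w dim2.
(* If the ray from [u] in direction [v] comes within [m / 4] of 0, it does so at a time at least
   [3 / 4], and then the opposite ray stays at distance at least [m / 2]. *)
have [e e1 eu] : exists2 e : R, `|e| = 1 &
    forall s, 0 <= s <= 4 -> m / 4 <= `|u + (s * m * e) *: v|.
  have [H|] := pselect (forall s : R, 0 <= s <= 4 -> m / 4 <= `|u + (s * m * 1) *: v|).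
    by exists 1; rewrite ?normr1.
  move=> /existsNP[s /not_implyP[/andP[s0 s4] /negP]]; rewrite -ltNge mulr1 => us.
  exists (-1); first by rewrite normrN1.
  move=> t /andP[t0 t4].
  have h1 : m - m / 4 <= s * m.
    have := ler_normB (u + (s * m) *: v) ((s * m) *: v).
    by rewrite addrK um normrZ v1 mulr1 ger0_norm ?mulr_ge0 ?(ltW m0) //; lra.
  have := ler_normB (u + (s * m) *: v) (u + (t * m * -1) *: v).
  rewrite opprD addrACA subrr add0r -scalerBl normrZ v1 mulr1 mulrN1 opprK.
  rewrite ger0_norm; first by have := mulr_ge0 t0 (ltW m0); lra.
  by rewrite addr_ge0 // mulr_ge0 // ltW.
set p := (4 * m * e) *: v.
have np : `|p| = 4 * m by rewrite /p normrZ v1 mulr1 normrM e1 mulr1 gtr0_norm ?mulr_gt0.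
(* Length [4 * m] at boundary distance [3 * m / 20] needs at least 107 links; 120 is a round bound,
   and the three legs give 360. *)
have seg z1 z2 : `|z2 - z1| <= 4 * m ->
    (forall t, 0 <= t <= 1 -> 4^-1 * m <= `|z1 + t *: (z2 - z1) - a|) -> chain G 120 z1 z2.
  move=> z12 Hz; apply: (@chain_segment _ _ _ _ _ _ ((4^-1 - 10^-1) * m)) => //.
    by move=> t /Hz; exact: Gd.
  lra.
have c1 : chain G 120 x (x + p).
  apply: seg; first by rewrite addrC addKr np.
  move=> t /andP[t0 t1]; rewrite [x + p]addrC addrK addrAC -/w /p scalerA.
  have h1 := Hv 1 (t * (4 * m * e)); rewrite scale1r normrM [`|_ * e|]normrM e1 mulr1 in h1.
  have h2 := ler_normB (w + (t * (4 * m * e)) *: v) ((t * (4 * m * e)) *: v).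
  rewrite addrK [X in _ <= _ + X]normrZ v1 mulr1 normrM [`|_ * e|]normrM e1 mulr1 in h2.
  by rewrite -/m in h2; move: h1 h2; rewrite (ger0_norm t0) gtr0_norm ?mulr_gt0 //; lra.
have c2 : chain G 120 (x + p) (y + p).
  have xy : `|y - x| <= 2 * m.
    by have := ler_distD a y x; rewrite (distrC a) um -/m; lra.
  apply: seg; first by rewrite opprD addrACA subrr addr0; lra.
  move=> t /andP[t0 t1]; set q := x + p + _ - a.
  have qE : q = p + ((1 - t) *: w + t *: u).
    rewrite /q (_ : y + p - (x + p) = u - w); last first.
      by rewrite opprD addrACA subrr addr0 /u /w opprB addrA subrK.
    rewrite addrAC (_ : x + p - a = p + w); last by rewrite [x + p]addrC -addrA.
    by rewrite -addrA; congr (p + _); rewrite scalerBr scalerBl scale1r addrA addrAC.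
  have := ler_normB q ((1 - t) *: w + t *: u); rewrite {1}qE addrK np.
  have := ler_normD ((1 - t) *: w) (t *: u); rewrite !normrZ um -/m.
  by rewrite (ger0_norm t0) ger0_norm ?subr_ge0 //; lra.
have c3 : chain G 120 (y + p) y.
  apply: chain_sym; apply: seg; first by rewrite addrC addKr np.
  move=> t /andP[t0 t1]; rewrite [y + p]addrC addrK addrAC -/u /p scalerA.
  by have := eu (t * 4) ltac:(lra); rewrite !mulrA; lra.
exact: (chain_trans (chain_trans c1 c2) c3).
Qed.

(** The farther point descends radially to the sphere of the other one in at most [L.+1] halvings of
    8 links each; then 360 links go around the sphere. *)
Lemma exterior_log_chain G a x y (r : R) (L : nat) : dim_ge2 E -> open G -> bdry G a ->
  (forall b, bdry G b -> `|b - a| <= r) -> G x -> G y ->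
  10 * r <= dist_bdry G x -> 10 * r <= dist_bdry G y ->
  `|x - y| <= 2 ^+ L * dist_bdry G x -> `|x - y| <= 2 ^+ L * dist_bdry G y ->
  chain G (368 * L.+1) x y.
Proof.
move=> dim2 Go Ga Gr; have G0 : bdry G !=set0 by exists a.
wlog xy : x y / `|x - a| <= `|y - a|.
  move=> W Gx Gy rx ry xyx xyy; have [h|/ltW h] := leP `|x - a| `|y - a|; first exact: W.
  by apply: chain_sym; apply: W => //; rewrite distrC.
move=> Gx Gy rx ry xyx xyy.
set m := `|x - a|; set M := `|y - a|.
have dx : dist_bdry G x <= m by exact: dist_bdry_le.
have m0 : 0 < m by apply: lt_le_trans dx; exact: dist_bdry_gt0.
have M0 : 0 < M by apply: lt_le_trans xy.
have MV : M \is a GRing.unit by rewrite unitfE gt_eqF.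
have rm : 10 * r <= m by lra.
pose y1 := a + (m / M) *: (y - a).
have ny1 : `|y1 - a| = m.
  by rewrite /y1 addrC addKr normrZ -/M gtr0_norm ?divr_gt0 // divrK.
have ML : M <= 2 ^+ L.+1 * m.
  have := ler_distD x y a; rewrite -/m -/M (distrC y).
  have : 1 <= 2 ^+ L :> R by rewrite exprn_ege1 // ler1n.
  have : 2 ^+ L * dist_bdry G x <= 2 ^+ L * m by rewrite ler_wpM2l // exprn_ge0.
  by rewrite exprS; nra.
have cy : chain G (8 * L.+1) (a + (y - a)) y1.
  apply: (@chain_halving _ _ _ (m / M)); rewrite ?divr_gt0 //.
  - move=> s /andP[ms s1]; have s0 : 0 < s by apply: lt_le_trans ms; rewrite divr_gt0.
    have := dist_bdry_ge (a + s *: (y - a)) G0 Gr; rewrite [_ - a]addrC addKr normrZ -/M.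
    rewrite (gtr0_norm s0); have : m <= s * M by rewrite -ler_pdivrMr.
    lra.
  - by rewrite lexx ler_pdivrMr // mul1r.
  - by rewrite mulrA ler_pdivlMr // mul1r.
rewrite addrC subrK in cy.
have cx : chain G 360 x y1 by apply: exterior_sphere_chain rm ny1.
apply: chain_le (chain_trans cx (chain_sym cy)); nat_lia.
Qed.

End Exterior.

(** * Distortion of relative distances *)

Section FarPoints.
Context {R : realType}.

(* What is used of a CQH map that is quasimoebius relative to the boundary. It is stated
   for one direction only, so that it applies to [f] and to its inverse; distortion of
   cross ratios is of power type, which is automatic because domains are connected. *)
Record qm_pair (K Q : nat) (E E' : completeNormedModType R) (G : set E) (G' : set E')
    (f : E -> E') : Prop := {
  qp_open : open G;
  qp_open' : open G';
  qp_bdry0 : bdry G !=set0;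
  qp_bdry0' : bdry G' !=set0;
  qp_in : forall x, G x -> G' (f x);
  qp_bdry : forall a, bdry G a -> bdry G' (f a);
  qp_surj : forall a', bdry G' a' -> exists2 a, bdry G a & f a = a';
  qp_cont : {within closure G, continuous f};
  qp_chain : forall n x y, G x -> G y -> chain G n x y -> chain G' (K * n.+1) (f x) (f y);
  qp_qm : forall (l : nat) a b u v, bdry G a -> bdry G b -> G u -> G v ->
    `|u - a| * `|v - b| <= 2 ^+ l * (`|u - b| * `|v - a|) ->
    `|f u - f a| * `|f v - f b| <= 2 ^+ (Q * l.+1) * (`|f u - f b| * `|f v - f a|);
  qp_qmV : forall a b u v, bdry G a -> bdry G b -> G u -> G v ->
    `|f u - f a| * `|f v - f b| <= 4 * (`|f u - f b| * `|f v - f a|) ->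
    `|u - a| * `|v - b| <= 2 ^+ Q * (`|u - b| * `|v - a|) }.

Context {K Q : nat} {E E' : completeNormedModType R} {G : set E} {G' : set E'} {f : E -> E'}.
Hypothesis fp : qm_pair K Q G G' f.

Let Go := qp_open fp.
Let G0 := qp_bdry0 fp.

(* On the segment from [y] towards a nearly closest boundary point [a], a point [z] whose
   image is at distance comparable to [r'] from [bdry G'] must be close to [a], since
   quasihyperbolic distance is not expanded too much; then all of [bdry G] is close to
   [z] because of quasimoebius distortion. *)
Lemma far_point_preimage (l : nat) y b' (r' : R) : G y -> bdry G' b' -> 0 < r' ->
  (forall e', bdry G' e' -> `|e' - b'| <= r') ->
  2 ^+ ((K * (8 * Q + 41) + 4) * l.+1) * r' <= `|f y - b'| ->
  exists a r, [/\ bdry G a, forall e, bdry G e -> `|e - a| <= r & 2 ^+ l * r <= dist_bdry G y].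
Proof.
move=> Gy Gb' r'0 Gr'; set D := `|f y - b'| => hD.
(* The summand [Q] absorbs the quasimöbius loss and 4 the factor 16 in [hk]. The choice of [eps]
   makes up for [a] being only nearly closest: the boundary distance at [a + s *: v] is at least
   [s * |v| / 2] as soon as [2 ^+ l' * s >= 1]. *)
set l' := (l + Q + 4)%N; set eps : R := (2 ^+ l'.+1)^-1.
have p2 n : 0 < 2 ^+ n :> R by rewrite exprn_gt0.
have eps0 : 0 < eps by rewrite invr_gt0.
have epsE : 2 ^+ l' * eps = 2^-1.
  by rewrite /eps exprS invfM mulrCA mulfV ?gt_eqF // mulr1.
have p2ge1 n : 1 <= 2 ^+ n :> R by rewrite exprn_ege1 // ler1n.
have eps1 : eps <= 2^-1 by rewrite -epsE ler_peMl // ltW.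
have dy := dist_bdry_gt0 Go G0 Gy; set d := dist_bdry G y in dy *.
have D16 : 16 * r' <= D.
  apply: le_trans hD; rewrite ler_pM2r // (_ : 16 = 2 ^+ 4); last by rewrite -natrX.
  by rewrite ler_weXn2l ?ler1n //; nat_lia.
have [a0 Ga0 ya0] := dist_bdry_approx y G0 (mulr_gt0 eps0 dy); rewrite -/d in ya0.
have [t [/andP[t0 t1] Ga HG]] := segment_exit Go Gy Ga0.2.
set a := y + t *: (a0 - y) in Ga.
set v := y - a.
have vE : v = - (t *: (a0 - y)) by rewrite /v /a opprD addNKr.
have nv : `|v| <= (1 + eps) * d.
  rewrite vE normrN normrZ gtr0_norm // distrC.
  by have : t * `|y - a0| <= `|y - a0|; [rewrite ler_piMl|lra].
have dv : d <= `|v| by apply: dist_bdry_le.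
have v0 : 0 < `|v| by lra.
have inG s : 0 < s -> s <= 1 -> G (a + s *: v).
  move=> s0 s1; have := HG ((1 - s) * t); rewrite mulr_ge0 ?subr_ge0 ?(ltW t0) //=.
  rewrite (_ : y + _ = a + s *: v); first by apply; rewrite gtr_pMl //; lra.
  by rewrite /a vE -scalerA scalerBl scale1r scalerN addrA.
(* The value [3 * r'] is attained because the image starts within [r'] of [b'] at the boundary point
   [a] and ends at distance [D >= 16 * r']. *)
have [s1 [/andP[s10 s11] hs1 _]] : exists s1, [/\ 0 <= s1 <= 1, `|f (a + s1 *: v) - b'| = 3 * r'
    & forall u, 0 <= u <= s1 -> `|f (a + u *: v) - b'| <= 3 * r'].
  apply: (@first_hitting R (fun s => `|f (a + s *: v) - b'|)) => //.
  - apply/within_continuous_epsP => s; rewrite /= in_itv /= => /andP[s0 s1] e e0.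
    have cl u : 0 <= u -> u <= 1 -> closure G (a + u *: v).
      rewrite le_eqVlt => /predU1P[<- _|u0 u1]; first by rewrite scale0r addr0; case: Ga.
      by apply: subset_closure; exact: inG.
    have [h h0 Hh] := (within_continuous_epsP _ _).1 (qp_cont fp) _ (cl s s0 s1) e e0.
    exists (h / `|v|); first by rewrite divr_gt0.
    move=> u; rewrite /= in_itv /= => /andP[u0 u1]; rewrite ltr_pdivlMr // => su.
    apply: le_lt_trans (Hh (a + u *: v) (cl u u0 u1) _); last by rewrite dist_line.
    by apply: (le_trans (ler_dist_dist _ _)); rewrite opprB addrA subrK.
  - rewrite scale0r addr0; have := Gr' _ (qp_bdry fp Ga); lra.
  - by rewrite scale1r /v [a + _]addrC subrK -/D; lra.
have s1p : 0 < s1.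
  rewrite lt_neqAle s10 andbT; apply/eqP => E0; move: hs1; rewrite -E0 scale0r addr0.
  by have := Gr' _ (qp_bdry fp Ga); lra.
set z := a + s1 *: v in hs1; have Gz : G z by exact: inG.
have dfy : D - r' <= dist_bdry G' (f y) by apply: dist_bdry_ge; [exact: qp_bdry0' fp|].
(* Otherwise [8 * l'] links lead from [y] to [z], and [D] is at most [2 ^+ N * (4 * r')] with
   [N = K * (8 * l' + 1)]. The exponent in the hypothesis is chosen so that [N + 3] is at most that
   exponent. *)
have close : 2 ^+ l' * s1 < 1.
  rewrite ltNge; apply/negP => hs.
  have c1 : chain G (8 * l') (a + v) z.
    apply: (@chain_halving _ _ G a v s1) => //; last by rewrite lexx.
    move=> s /andP[s1s sle].
    have hes : 2 * eps <= s.
      have : 1 <= 2 ^+ l' * s by apply: (le_trans hs); rewrite ler_wpM2l // ltW.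
      by rewrite -ler_pdivrMl // mulr1 /eps exprS invfM mulrA mulfV ?mul1r.
    have := dist_bdry_lip y (a + s *: v) G0; rewrite -/d.
    have -> : y - (a + s *: v) = (1 - s) *: v by rewrite scalerBl scale1r opprD addrA.
    rewrite normrZ ger0_norm ?subr_ge0 // => h.
    have : eps * d <= eps * `|v| by rewrite ler_wpM2l // ltW.
    have : 2 * eps * `|v| <= s * `|v| by rewrite ler_wpM2r.
    lra.
  rewrite /v [a + _]addrC subrK in c1.
  have := chain_dist_bdry (qp_bdry0' fp) (qp_chain fp Gy Gz c1).
  have hz : dist_bdry G' (f z) <= 3 * r' by rewrite -hs1; exact: dist_bdry_le.
  set N := (K * (8 * l').+1)%N => hc.
  have h1 : D <= 2 ^+ N * (4 * r').
    have := p2ge1 N.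
    have : 2 ^+ N * dist_bdry G' (f z) <= 2 ^+ N * (3 * r') by rewrite ler_wpM2l // ltW.
    by nra.
  have h2 : 2 ^+ N.+3 * r' <= D.
    apply: le_trans hD; rewrite ler_pM2r // ler_weXn2l ?ler1n // /N /l'.
    by clear; nia.
  have := mulr_gt0 (p2 N) r'0; rewrite !exprS in h2; lra.
(* In the image, the distances from [f z] to [f a] and [f e] lie between [2 * r'] and [4 * r'], and
   those from [f y] are both nearly [D], so the hypothesis of [qp_qmV] holds for every [e]. *)
have hQ e : bdry G e -> `|z - e| <= 2 ^+ Q * s1 * `|y - e|.
  move=> Ge; have := qp_qmV fp Ga Ge Gy Gz.
  have z_a : `|z - a| = s1 * `|v| by rewrite /z addrC addKr normrZ gtr0_norm.
  rewrite z_a -/v; set P := _ <= _; have HP : P.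
    have h1 := Gr' _ (qp_bdry fp Ga); have h2 := Gr' _ (qp_bdry fp Ge).
    have i1 : `|f y - f a| <= D + r' by have := ler_distD b' (f y) (f a); rewrite (distrC b') -/D; lra.
    have i2 : `|f z - f e| <= 4 * r' by have := ler_distD b' (f z) (f e); rewrite (distrC b'); lra.
    have i3 : D - r' <= `|f y - f e| by have := ler_distD (f e) (f y) b'; rewrite -/D; lra.
    have i4 : 2 * r' <= `|f z - f a| by have := ler_distD (f a) (f z) b'; lra.
    rewrite /P; apply: (@le_trans _ _ ((D + r') * (4 * r'))); first by apply: ler_pM.
    apply: (@le_trans _ _ (4 * ((D - r') * (2 * r')))).
      have : 0 <= r' * (D - 16 * r') by rewrite mulr_ge0 ?subr_ge0 // ltW.
      have := mulr_gt0 r'0 r'0; lra.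
    by rewrite ler_pM2l //; apply: ler_pM => //; lra.
  move=> /(_ HP) h; rewrite -(ler_pM2l v0); lra.
set k := 2 ^+ Q * s1 in hQ.
have hk : 2 ^+ l * (16 * k) < 1.
  apply: le_lt_trans close; rewrite /k /l' !exprD (_ : 2 ^+ 4 = 16) ?lexx; first lra.
  by rewrite -natrX.
have s1k : s1 <= k by rewrite /k ler_peMl.
have pk : 0 < k by rewrite mulr_gt0.
have k16 : 16 * k < 1 by apply: le_lt_trans hk; rewrite ler_peMl // mulr_ge0 // ltW.
(* As [k < 1 / 16], [hQ] forces [|y - e| <= 2 * |v|]. Hence [e] is within [4 * k * d] of [z], and
   [a] is within [2 * k * d]. *)
exists a, (8 * k * d); split => //; last by have := ltr_pM2r dy (2 ^+ l * (16 * k)) 1; rewrite hk; lra.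
move=> e Ge; have h := hQ e Ge.
have z_a : `|z - a| = s1 * `|v| by rewrite /z addrC addKr normrZ gtr0_norm.
have h1 := ler_distD a y e; have h2 := ler_distD z a e; have h3 := ler_distD z e a.
rewrite -/v (distrC a z) z_a in h1 h2; rewrite (distrC e z) z_a in h3.
have h4 : s1 * `|v| <= k * `|v| by rewrite ler_wpM2r.
have h5 : k * `|y - e| <= `|y - e| / 16.
  by rewrite mulrC ler_wpM2l //; lra.
have h6 : k * `|v| <= `|v| / 16 by rewrite mulrC ler_wpM2l //; lra.
have h7 : `|y - e| <= 2 * `|v| by lra.
have h8 : k * `|y - e| <= k * (2 * `|v|) by rewrite ler_wpM2l // ltW.
have h9 : k * `|v| <= k * (2 * d).
  rewrite ler_wpM2l ?(ltW pk) //; apply: (le_trans nv).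
  by rewrite ler_wpM2r ?(ltW dy) //; lra.
by have := mulr_gt0 pk dy; lra.
Qed.

End FarPoints.

Section RelativeDistance.
Context {R : realType}.
Context {K Q : nat} {E E' : completeNormedModType R} {G : set E} {G' : set E'} {f : E -> E'}.
Hypothesis fp : qm_pair K Q G G' f.

Let Go := qp_open fp.
Let G0 := qp_bdry0 fp.

(* The quasimoebius condition needs a second boundary point. If the boundary of [G'] has
   no point far enough from the one nearest to [f x], then [f y] lies far outside of
   [bdry G'], and both [x] and [y] lie far outside of [bdry G] by [far_point_preimage]. *)
Lemma rel_distortion (L : nat) x y : dim_ge2 E ->
  (exists a b, [/\ bdry G' a, bdry G' b & a != b]) -> G x -> G y ->
  `|x - y| <= 2 ^+ L * dist_bdry G x -> `|x - y| <= 2 ^+ L * dist_bdry G y ->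
  `|f x - f y| <= 2 ^+ ((9 + 3 * Q + 6 * (K * (8 * Q + 41) + 4) + 369 * K) * L.+1) *
    dist_bdry G' (f x).
Proof.
move=> dim2 two Gx Gy xyx xyy.
have p2 n : 0 < 2 ^+ n :> R by rewrite exprn_gt0.
have p2ge1 n : 1 <= 2 ^+ n :> R by rewrite exprn_ege1 // ler1n.
have Gfx := qp_in fp Gx; have Gfy := qp_in fp Gy.
have dfx := dist_bdry_gt0 (qp_open' fp) (qp_bdry0' fp) Gfx.
set d' := dist_bdry G' (f x) in dfx *.
have [b' Gb' xb'] := dist_bdry_approx (f x) (qp_bdry0' fp) dfx; rewrite -/d' in xb'.
have [b Gb fb] := qp_surj fp Gb'.
set D := `|f y - b'|; set P := `|f x - b'| in xb'.
have P0 : 0 < P by apply: lt_le_trans dfx _; exact: dist_bdry_le.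
have D0 : 0 <= D by exact: normr_ge0.
(* [W] is the loss in one use of the quasimöbius condition, [Lam] the ratio beyond which
   [far_point_preimage] applies, and [V] the loss along a chain outside the boundary. *)
set w := (Q * (2 * L + 3))%N; set K2 := (K * (8 * Q + 41) + 4)%N.
set N4 := (K * (368 * L.+1).+1)%N; set W : R := 2 ^+ w; set Lam : R := 2 ^+ (K2 * (L + 6)).
set V : R := 2 ^+ N4.
have W1 : 1 <= W by exact: p2ge1. have Lam1 : 1 <= Lam by exact: p2ge1.
have V1 : 1 <= V by exact: p2ge1.
have WL1 : 1 <= W * Lam by rewrite mulr_ege1.
have WLV1 : 1 <= W * Lam * V by rewrite mulr_ege1.
suff goal : D <= 128 * (W * Lam * V) * P.
  apply: (@le_trans _ _ (2 ^+ 9 * (W * Lam * V) * d')).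
    have : `|f x - f y| <= P + D.
      by have := ler_distD b' (f x) (f y); rewrite (distrC b').
    have h1 : P <= (W * Lam * V) * P by rewrite ler_peMl // ltW.
    have h2 : W * Lam * V * P <= W * Lam * V * (2 * d').
      by rewrite ler_wpM2l; [|lra|lra].
    have -> : 2 ^+ 9 = 512 :> R by rewrite -natrX.
    have : 0 <= W * Lam * V * d' by rewrite mulr_ge0 //; lra.
    lra.
  rewrite ler_wpM2r ?(ltW dfx) // /W /Lam /V -!exprD ler_weXn2l ?ler1n //.
  by rewrite /w /N4 -/K2; move: (K2) => K2'; clear; nia.
have Lx : (1 + 2 ^+ L) <= 2 ^+ L.+1 :> R by rewrite exprS; have := p2ge1 L; lra.
have qm a : bdry G a -> D * `|f x - f a| <= W * (P * `|f y - f a|).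
  move=> Ga; have := qp_qm fp (l := (L + L).+2) Gb Ga Gy Gx.
  rewrite fb -/D -/P (_ : (Q * (L + L).+3 = w)%N); last by rewrite /w; nat_lia.
  rewrite -/W (mulrC P); apply.
  have h1 : `|y - b| <= 2 ^+ L.+1 * `|x - b|.
    apply: (@le_trans _ _ ((1 + 2 ^+ L) * `|x - b|)); last by rewrite ler_wpM2r.
    have := ler_distD x y b; rewrite (distrC y x).
    have : 2 ^+ L * dist_bdry G x <= 2 ^+ L * `|x - b| by rewrite ler_wpM2l ?dist_bdry_le // ltW.
    lra.
  have h2 : `|x - a| <= 2 ^+ L.+1 * `|y - a|.
    apply: (@le_trans _ _ ((1 + 2 ^+ L) * `|y - a|)); last by rewrite ler_wpM2r.
    have := ler_distD y x a.
    have : 2 ^+ L * dist_bdry G y <= 2 ^+ L * `|y - a| by rewrite ler_wpM2l ?dist_bdry_le // ltW.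
    lra.
  apply: (le_trans (ler_pM _ _ h1 h2)) => //.
  rewrite (_ : (L + L).+2 = (L.+1 + L.+1)%N); last by nat_lia.
  by rewrite exprD; lra.
have big (T : R) : 0 <= T -> T <= 128 * (W * Lam * V) -> D <= T * P -> D <= 128 * (W * Lam * V) * P.
  by move=> T0 TT h; apply: (le_trans h); rewrite ler_wpM2r // ltW.
have WLV : W <= W * Lam * V.
  by rewrite -mulrA ler_peMr ?mulr_ege1 //; lra.
have WLLV : W * Lam <= W * Lam * V by rewrite ler_peMr //; lra.
have VLLV : V <= W * Lam * V by rewrite ler_peMl //; lra.
(* If a boundary point [f a] is at least [D / 10] from [b'], then unless [D <= 100 * P] its distance
   to [f x] is nearly that to [b'], and [qm] bounds [D / P]. *)
have [[a Ga Da]|far] := pselect (exists2 a, bdry G a & D <= 10 * `|f a - b'|).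
  have [h|h] := leP D (100 * P); first by apply: (big 100) => //; lra.
  have h1 : `|f y - f a| <= 11 * `|f a - b'|.
    by have := ler_distD b' (f y) (f a); rewrite (distrC b') -/D; lra.
  have h2 : 9 / 10 * `|f a - b'| <= `|f x - f a|.
    by have := ler_distD (f x) (f a) b'; rewrite (distrC (f a) (f x)) -/P; lra.
  have e0 : 0 < `|f a - b'| by lra.
  apply: (big (13 * W)); [lra|lra|].
  rewrite -(ler_pM2r e0).
  have h3 : D * (9 / 10 * `|f a - b'|) <= D * `|f x - f a| by rewrite ler_wpM2l.
  have WP : 0 <= W * P by rewrite mulr_ge0 ?(ltW P0) //; lra.
  have h4 : W * P * `|f y - f a| <= W * P * (11 * `|f a - b'|) by rewrite ler_wpM2l.
  have := qm a Ga; have := mulr_ge0 WP (ltW e0); lra.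
have {}far a' : bdry G' a' -> 10 * `|a' - b'| <= D.
  move=> /(qp_surj fp)[a Ga <-]; rewrite leNgt; apply/negP => /ltW h.
  by apply: far; exists a.
(* From here on [bdry G'] lies in the ball of radius [D / 10] about [b']. The supremum is positive
   because there are two boundary points. *)
pose S := [set `|a' - b'| | a' in bdry G'].
have hS : has_sup S.
  split; first by exists `|b' - b'|, b'.
  by exists (D / 10) => _ [a' /far h <-]; lra.
have Sr a' : bdry G' a' -> `|a' - b'| <= sup S.
  by move=> Ga'; apply: sup_ubound; [case: hS|exists a'].
have r0 : 0 < sup S.
  have [a1 [a2 [Ga1 Ga2 a12]]] := two.
  have n0 : 0 < `|a1 - a2| by rewrite normr_gt0 subr_eq0.
  have := ler_distD b' a1 a2; rewrite (distrC b'); have := Sr _ Ga1; have := Sr _ Ga2; lra.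
set r := sup S in Sr r0.
have Dr : 10 * r <= D.
  suff : r <= D / 10 by lra.
  by apply: ge_sup => [|_ [a' /far h <-]]; [case: hS|lra].
have [_ [a' Ga' <-] ar] := sup_adherent (divr_gt0 r0 (ltr0n R 2)) hS.
rewrite -/r in ar; have [a Ga fa] := qp_surj fp Ga'; rewrite -{a' Ga'}fa in ar.
(* The second boundary point is now [f a], at distance more than [r / 2] from [b']. *)
have rP : r <= 5 * W * P.
  have WP : P <= W * P by rewrite ler_peMl // ltW.
  have [h|h] := leP r (4 * P); first lra.
  have h1 : r / 4 <= `|f x - f a|.
    by have := ler_distD (f x) (f a) b'; rewrite (distrC (f a) (f x)) -/P; lra.
  have h2 : `|f y - f a| <= 11 / 10 * D.
    have := Sr _ (qp_bdry fp Ga); have := ler_distD b' (f y) (f a).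
    by rewrite (distrC b') -/D; lra.
  have Dp : 0 < D by lra.
  have := qm a Ga => h3; rewrite -(ler_pM2l Dp).
  have h4 : D * (r / 4) <= D * `|f x - f a| by rewrite ler_wpM2l.
  have WP0 : 0 <= W * P by lra.
  have h5 : W * P * `|f y - f a| <= W * P * (11 / 10 * D) by rewrite ler_wpM2l.
  by have := mulr_ge0 WP0 (ltW Dp); lra.
have [DL|DL] := leP D (Lam * r).
  apply: (big (5 * (W * Lam))); [lra|lra|].
  have : Lam * r <= Lam * (5 * W * P) by rewrite ler_wpM2l //; lra.
  lra.
(* Since [2 ^+ (L + 5) = 16 * 2 ^+ L.+1], the factor [2 ^+ L.+1] can be spent on passing from [y] to
   [x], and 16 exceeds the 10 required by [exterior_log_chain]. *)
have DL' : 2 ^+ (K2 * (L + 5).+1) * r <= D by rewrite -addnS; exact: ltW.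
have [a0 [rho [Ga0 Grho rhoy]]] := far_point_preimage fp Gy Gb' r0 Sr DL'.
have rho0 : 0 <= rho by apply: le_trans (Grho a Ga).
have e32 : 2 ^+ (L + 5) = 16 * 2 ^+ L.+1 :> R.
  have e5 : 2 ^+ 5 = 32 :> R by rewrite -natrX.
  by rewrite addnC exprD e5 exprS; lra.
rewrite e32 in rhoy.
have dxy : dist_bdry G y <= 2 ^+ L.+1 * dist_bdry G x.
  apply: (@le_trans _ _ ((1 + 2 ^+ L) * dist_bdry G x)); last first.
    by rewrite ler_wpM2r // dist_bdry_ge0.
  by have := dist_bdry_lip y x G0; rewrite distrC; lra.
have rx : 16 * rho <= dist_bdry G x by rewrite -(ler_pM2l (p2 L.+1)); lra.
have ry : 16 * rho <= dist_bdry G y.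
  by apply: le_trans rhoy; have := mulr_ge0 (ltW (p2 L)) rho0;
     have : rho <= 2 ^+ L.+1 * rho; [rewrite ler_peMl|lra].
have c : chain G (368 * L.+1) x y by apply: (exterior_log_chain dim2 Go Ga0 Grho) => //; lra.
have := chain_dist_bdry (qp_bdry0' fp) (chain_sym (qp_chain fp Gx Gy c)).
rewrite -/N4 -/V -/d' => h1.
have h2 : d' <= P by exact: dist_bdry_le.
have h3 : D - r <= dist_bdry G' (f y) by apply: dist_bdry_ge; [exact: qp_bdry0' fp|].
have h4 : V * d' <= V * P by rewrite ler_wpM2l //; lra.
apply: (big (2 * V)); lra.
Qed.

End RelativeDistance.

(** * Diameter uniform domains *)

Section DiameterUniform.
Context {R : realType} {E : completeNormedModType R}.
Implicit Types (A B : set E) (G : set E).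

Lemma diam_leP A (r : R) :
  (diam A <= r%:E)%E <-> forall x y, A x -> A y -> `|x - y| <= r.
Proof.
split=> [h x y Ax Ay|h].
  rewrite -lee_fin; apply: le_trans h; apply: ereal_sup_ubound.
  by exists x, y.
by apply: ub_ereal_sup => _ [x [y [Ax Ay ->]]]; rewrite lee_fin h.
Qed.

Lemma diam_sub A B : A `<=` B -> (diam A <= diam B)%E.
Proof.
move=> AB; apply: ereal_sup_le => _ [x [y [Ax Ay ->]]].
by exists x, y; split=> //; exact: AB.
Qed.

(* The form in which the naturality of [G'] is pulled back to [G]. *)
Definition tame_chain (T : R) (N0 : nat) G := forall A, connected A -> A `<=` G ->
  (forall x y, A x -> A y -> `|x - y| <= T * dist_bdry G x) ->
  forall x y, A x -> A y -> chain G N0 x y.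

Lemma link_near G (w v1 v2 : E) : bdry G !=set0 ->
  `|w - v1| < dist_bdry G w / 16 -> `|w - v2| < dist_bdry G w / 16 -> link G v1 v2.
Proof.
move=> G0 h1 h2; apply: link_close => //.
have := ler_distD w v1 v2; have := dist_bdry_lip w v1 G0.
have := normr_ge0 (w - v1).
by rewrite (distrC v1 w); lra.
Qed.

Lemma curve_piece_chain G (c : R) N0 (sigma : R -> E) a b x y : tame_chain (2 * c) N0 G ->
  {within `[0, 1], continuous sigma} -> sigma @` `[0, 1] `<=` G ->
  0 <= a -> a <= b -> b <= 1 ->
  (forall s t, a <= s <= b -> a <= t <= b ->
    `|sigma s - sigma t| <= 2 * c * dist_bdry G (sigma s)) ->
  a <= x <= b -> a <= y <= b -> chain G N0 (sigma x) (sigma y).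
Proof.
move=> HN sc sG a0 ab b1 H xab yab.
have sub : `[a, b] `<=` `[0, 1].
  by move=> s; rewrite /= !in_itv /= => /andP[sa sb]; apply/andP; split; lra.
apply: (HN (sigma @` `[a, b])).
- apply: connected_continuous_connected; first exact: segment_connected.
  exact: continuous_subspaceW sub sc.
- by move=> _ [s /sub s01 <-]; apply: sG; exists s.
- by move=> _ _ [s sab <-] [t tab <-]; apply: H; [move: sab|move: tab]; rewrite /= in_itv.
- by exists x => //=; rewrite in_itv.
- by exists y => //=; rewrite in_itv.
Qed.

(* The arc is cut where the diameter of its initial part doubles; on each piece the
   boundary distance is comparable to that diameter. *)
Lemma half_arc_chain G (c : R) N0 (sigma : R -> E) (s1 : R) :
  1 <= c -> open G -> bdry G !=set0 -> tame_chain (2 * c) N0 G ->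
  {within `[0, 1], continuous sigma} -> sigma @` `[0, 1] `<=` G -> 0 <= s1 -> s1 <= 1 ->
  (forall u, 0 <= u <= s1 ->
    (diam (sigma @` `[0%R, u]) <= (c * dist_bdry G (sigma u))%:E)%E) ->
  forall (l : nat) u, 0 <= u <= s1 ->
    (diam (sigma @` `[0%R, u]) <= (2 ^+ l * dist_bdry G (sigma 0))%:E)%E ->
    chain G (N0.+1 * l.+1) (sigma 0) (sigma u).
Proof.
move=> c1 Go G0 HN sc sG s10 s11 Hc; set d0 := dist_bdry G (sigma 0).
have sGt t : 0 <= t <= 1 -> G (sigma t).
  by move=> t01; apply: sG; exists t; rewrite //= in_itv.
have d00 : 0 < d0 by apply: dist_bdry_gt0 => //; apply: sGt; rewrite lexx ler01.
have mem u t : 0 <= t <= u -> (sigma @` `[0, u]) (sigma t).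
  by move=> tu; exists t; rewrite //= in_itv.
have dmono u v : u <= v -> (diam (sigma @` `[0%R, u]) <= diam (sigma @` `[0%R, v]))%E.
  move=> uv; apply: diam_sub => _ [t + <-]; rewrite /= in_itv /= => /andP[t0 tu].
  by apply: mem; rewrite t0 (le_trans tu).
elim=> [|l IH] u /andP[u0 us1] Hu.
  rewrite expr0 mul1r in Hu; have {}Hu := (diam_leP _ _).1 Hu.
  apply: (chain_le (m := N0)); first by rewrite muln1.
  apply: (curve_piece_chain (a := 0) (b := u) HN sc sG); rewrite ?lexx ?u0 ?(le_trans us1) //.
  move=> s t /andP[s0 su] tu.
  have h1 : `|sigma s - sigma t| <= d0 by apply: Hu; apply: mem => //; rewrite s0.
  have h2 : `|sigma 0 - sigma s| <= c * dist_bdry G (sigma s).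
    have su1 : 0 <= s <= s1 by rewrite s0 (le_trans su).
    by apply: ((diam_leP _ _).1 (Hc _ su1)); apply: mem; rewrite ?lexx s0 ?lexx.
  have h3 := dist_bdry_lip (sigma 0) (sigma s) G0; rewrite -/d0 in h3.
  have h4 : dist_bdry G (sigma s) <= c * dist_bdry G (sigma s).
    by rewrite ler_peMl // dist_bdry_ge0.
  lra.
have [h|/negP h] := boolP (diam (sigma @` `[0%R, u]) <= (2 ^+ l * d0)%:E)%E.
  by apply: chain_le (IH u _ h); rewrite ?u0 // leq_mul2l leqnSn orbT.
(* The diameter is not evaluated at the supremum [w]. Instead [v1] in [S] and [v2] outside [S] are
   taken so close to [w] that one link joins them; it is the 1 in [N0.+1]. *)
pose S := [set v | 0 <= v <= u /\ (diam (sigma @` `[0%R, v]) <= (2 ^+ l * d0)%:E)%E].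
have S0 : S 0.
  split; first by rewrite lexx u0.
  apply/diam_leP => _ _ [s + <-] [t + <-]; rewrite /= !in_itv /= => s0 t0.
  have -> : s = t by lra.
  by rewrite subrr normr0 mulr_ge0 ?exprn_ge0 // ltW.
have hS : has_sup S by split; [exists 0|exists u => v [/andP[]]].
set w := sup S.
have Sw v : S v -> v <= w by move=> Sv; apply: sup_ubound => //; case: hS.
have w0 : 0 <= w by exact: Sw.
have wu : w <= u by apply: ge_sup; [exists 0|move=> v [/andP[]]].
have w01 : 0 <= w <= 1 by rewrite w0 (le_trans wu) // (le_trans us1).
have dw := dist_bdry_gt0 Go G0 (sGt _ w01).
have e0 : 0 < dist_bdry G (sigma w) / 16 by rewrite divr_gt0.
have [|h0 h00 Hh] := (within_continuous_epsP _ _).1 sc w _ _ e0; first by rewrite /= in_itv.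
have [v1 Sv1 wv1] := sup_adherent h00 hS; rewrite -/w in wv1.
have v1w := Sw _ Sv1; have [/andP[v10 v1u] dv1] := Sv1.
set v2 := Num.min u (w + h0 / 2).
have v2u : v2 <= u by rewrite ge_min lexx.
have v2w : v2 <= w + h0 / 2 by rewrite ge_min lexx orbT.
have wv2 : w <= v2 by rewrite le_min wu /=; lra.
have nSv2 : ~ (diam (sigma @` `[0%R, v2]) <= (2 ^+ l * d0)%:E)%E.
  move=> h2; have Sv2 : S v2 by split; rewrite // v2u (le_trans w0).
  have v2w' := Sw _ Sv2; have [hu|hu] := leP u (w + h0 / 2).
    by apply: h; rewrite /v2 (min_idPl hu) in h2.
  by move: v2w'; rewrite /v2 (min_idPr (ltW hu)); lra.
have lk : link G (sigma v1) (sigma v2).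
  apply: (link_near (w := sigma w)) => //; apply: Hh.
  - by rewrite /= in_itv /= v10 (le_trans v1u) // (le_trans us1).
  - by rewrite ger0_norm; lra.
  - by rewrite /= in_itv /= (le_trans w0) // (le_trans v2u) // (le_trans us1).
  - by rewrite ler0_norm; lra.
(* Past [v2] the initial part has diameter above [2 ^+ l * d0], so [c] times the boundary distance
   exceeds this, while the total diameter is at most twice as large: hence the ratio [2 * c]. *)
have ch : chain G N0 (sigma v2) (sigma u).
  apply: (curve_piece_chain (a := v2) (b := u) HN sc sG); rewrite ?lexx ?v2u ?(le_trans w0) ?(le_trans us1) //.
  move=> s t /andP[sv2 su] /andP[tv2 tu].
  have h1 : `|sigma s - sigma t| <= 2 ^+ l.+1 * d0.
    apply: ((diam_leP _ _).1 Hu); apply: mem; apply/andP; split => //; lra.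
  have h2 : 2 ^+ l * d0 <= c * dist_bdry G (sigma s).
    rewrite leNgt; apply/negP => lt; apply: nSv2; apply: (le_trans (dmono _ _ sv2)).
    have su1 : 0 <= s <= s1 by apply/andP; split; lra.
    by apply: (le_trans (Hc _ su1)); rewrite lee_fin ltW.
  by rewrite exprS in h1; lra.
have := chain_trans (chain_trans (IH v1 _ dv1) (chain1 lk)) ch.
rewrite v10 (le_trans v1u) // => /(_ isT); apply: chain_le.
by rewrite mulnS; nat_lia.
Qed.

End DiameterUniform.

Section DiameterUniformDomain.
Context {R : realType}.

(** The arc is divided where its initial part stops being the one of smaller diameter. Both halves,
    the second one reversed, satisfy the one-sided cone condition of [half_arc_chain], and one link
    bridges the gap between them. *)
Lemma diameter_uniform_log_chain (c : R) (N0 : nat) : 1 <= c ->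
  exists K : nat, forall (E : completeNormedModType R) (G : set E),
    open G -> bdry G !=set0 -> tame_chain (2 * c) N0 G ->
    diameter_uniform_domain c G -> log_chain K G.
Proof.
move=> c1; have [C0 hC0] := le_exp2n c; exists (2 * (N0.+1 * C0.+1) + 1)%N.
move=> E G Go G0 HN HD x y L Gx Gy xyx xyy.
have [->|xy] := eqVneq x y; first exact: chainxx.
have [gamma [[gc _ gG g0 g1] glen gcone]] := HD x y Gx Gy xy.
pose S := [set t : R | 0 <= t <= 1 /\
  (diam (gamma @` `[0%R, t]) <= diam (gamma @` `[t, 1%R]))%E].
have gt1 t : 0 <= t <= 1 -> G (gamma t).
  by move=> t01; apply: gG; exists t; rewrite //= in_itv.
have imS a b a' b' : a' <= a -> b <= b' -> gamma @` `[a, b] `<=` gamma @` `[a', b'].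
  move=> aa bb _ [t + <-]; rewrite /= in_itv /= => /andP[ta tb]; exists t => //=.
  by rewrite in_itv /= (le_trans aa ta) (le_trans tb bb).
have diam_point t (r : R) : 0 <= r -> (diam (gamma @` `[t, t]) <= r%:E)%E.
  move=> r0; apply/diam_leP => _ _ [s + <-] [s' + <-]; rewrite /= !in_itv /= => st st'.
  have -> : s = s' by lra.
  by rewrite subrr normr0.
have S0 : S 0.
  split; first by rewrite lexx ler01.
  apply: (le_trans (diam_point 0 0 (lexx _))); apply: ereal_sup_ubound.
  exists (gamma 0), (gamma 0); rewrite subrr normr0.
  by split => //; exists 0; rewrite //= in_itv /= lexx ler01.
have Sdown s t : 0 <= s -> s <= t -> S t -> S s.
  move=> s0 st [/andP[t0 t1] h]; split; first by rewrite s0 (le_trans st).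
  apply: (le_trans (diam_sub (imS 0 s 0 t _ _))) => //; apply: (le_trans h).
  exact: diam_sub (imS _ _ _ _ _ _).
have inS t : S t -> (diam (gamma @` `[0%R, t]) <= (c * dist_bdry G (gamma t))%:E)%E.
  by move=> [t01 h]; have := gcone t t01; rewrite (min_idPl h).
have ninS t : 0 <= t <= 1 -> ~ S t ->
    (diam (gamma @` `[t, 1%R]) <= (c * dist_bdry G (gamma t))%:E)%E.
  move=> t01 nS; have [h|/ltW h] := leP (diam (gamma @` `[0%R, t])) (diam (gamma @` `[t, 1%R])).
    by exfalso; apply: nS.
  by have := gcone t t01; rewrite (min_idPr h).
have hS : has_sup S by split; [exists 0|exists 1 => v [/andP[]]].
set w := sup S.
have Sw v : S v -> v <= w by move=> Sv; apply: sup_ubound => //; case: hS.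
have w0 : 0 <= w by exact: Sw.
have w1 : w <= 1 by apply: ge_sup; [exists 0|move=> v [/andP[]]].
have w01 : 0 <= w <= 1 by rewrite w0.
have dw := dist_bdry_gt0 Go G0 (gt1 _ w01).
have e0 : 0 < dist_bdry G (gamma w) / 16 by rewrite divr_gt0.
have [|h0 h00 Hh] := (within_continuous_epsP _ _).1 gc w _ _ e0; first by rewrite /= in_itv.
have [s1 Ss1 ws1] := sup_adherent h00 hS; rewrite -/w in ws1.
have s1w := Sw _ Ss1; have [/andP[s10 s11] _] := Ss1.
set s2 := Num.min 1 (w + h0 / 2).
have s21 : s2 <= 1 by rewrite ge_min lexx.
have s2w : s2 <= w + h0 / 2 by rewrite ge_min lexx orbT.
have ws2 : w <= s2 by rewrite le_min w1 /=; lra.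
have s20 : 0 <= s2 by lra.
have lk : link G (gamma s1) (gamma s2).
  apply: (link_near (w := gamma w)) => //; apply: Hh.
  - by rewrite /= in_itv /= s10.
  - by rewrite ger0_norm; lra.
  - by rewrite /= in_itv /= s20.
  - by rewrite ler0_norm; lra.
have diamL (d : R) a b : 0 <= a -> b <= 1 -> 0 <= d -> `|x - y| <= 2 ^+ L * d ->
    (diam (gamma @` `[a, b]) <= (2 ^+ (L + C0) * d)%:E)%E.
  move=> a0 b1 d0 xyd; apply: (le_trans (diam_sub (imS _ _ 0 1 a0 b1))).
  apply: (le_trans glen); rewrite lee_fin addnC exprD -mulrA.
  by apply: ler_pM => //; lra.
have left : chain G (N0.+1 * (L + C0).+1) x (gamma s1).
  rewrite -g0; apply: (half_arc_chain c1 Go G0 HN gc gG s10 s11) => //.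
  - move=> u /andP[u0 us1]; apply: inS; exact: Sdown Ss1.
  - by rewrite s10 lexx.
  - by rewrite g0; apply: diamL => //; rewrite dist_bdry_ge0.
have right : chain G (N0.+1 * (L + C0).+1) y (gamma s2).
  pose sigma t := gamma (1 - t).
  have imE u : sigma @` `[0, u] = gamma @` `[1 - u, 1].
    apply/seteqP; split => _ [t + <-]; rewrite /= in_itv /= => /andP[t0 t1].
      by exists (1 - t); rewrite //= in_itv /=; lra.
    by exists (1 - t); rewrite /sigma //= ?in_itv /= ?opprB ?addrA ?[1 + t]addrC ?addrK //; lra.
  have sc : {within `[0, 1], continuous sigma}.
    apply/within_continuous_epsP => t; rewrite /= in_itv /= => t01 e' e'0.
    have [|r r0 Hr] := (within_continuous_epsP _ _).1 gc (1 - t) _ _ e'0.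
      by rewrite /= in_itv /=; lra.
    exists r => // t'; rewrite /= in_itv /= => t01' tt'; apply: Hr.
      by rewrite /= in_itv /=; lra.
    by rewrite opprD opprK addrACA subrr add0r addrC distrC.
  have sG : sigma @` `[0, 1] `<=` G by rewrite imE subrr.
  have -> : y = sigma 0 by rewrite /sigma subr0 g1.
  have -> : gamma s2 = sigma (1 - s2) by rewrite /sigma subKr.
  have s2' : 0 <= 1 - s2 by lra.
  have s2'' : 1 - s2 <= 1 by lra.
  apply: (half_arc_chain c1 Go G0 HN sc sG s2' s2'').
  - move=> u /andP[u0 us]; rewrite imE /sigma.
    have u1 : 0 <= 1 - u <= 1 by apply/andP; split; lra.
    (* A time [1 - u >= s2] belongs to [S] only if [s2 = 1]; then [1 - u = 1] and the second half is
       a point. *)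
    have [Su|] := pselect (S (1 - u)); last exact: ninS.
    have uw := Sw _ Su; have [h|h] := leP 1 (w + h0 / 2).
      have s2E : s2 = 1 by rewrite /s2 (min_idPl h).
      have -> : 1 - u = 1 by lra.
      by apply: diam_point; rewrite mulr_ge0 ?dist_bdry_ge0 //; lra.
    have s2E : s2 = w + h0 / 2 by rewrite /s2 (min_idPr (ltW h)).
    by exfalso; lra.
  - by rewrite s2' lexx.
  - rewrite imE /sigma subr0 g1; apply: diamL => //; first lra.
    by rewrite dist_bdry_ge0.
have := chain_trans (chain_trans left (chain1 lk)) (chain_sym right).
by apply: chain_le; clear; nia.
Qed.

End DiameterUniformDomain.

(** * Construction of the pair and conclusion *)

Section Gauge.
Context {R : realType}.

Lemma gauge_bound (eta : R -> R) (b : R) : 0 <= b ->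
  homeomorphism_on [set t : R | 0 <= t] [set t : R | 0 <= t] eta ->
  exists B : R, forall t, 0 <= t <= b -> eta t <= B.
Proof.
move=> b0 [_ ec _].
have [|t _ Ht] := @EVT_max R eta 0 b b0.
  by apply: continuous_subspaceW ec => t; rewrite /= in_itv /= => /andP[].
by exists (eta t) => s s0b; apply: Ht; rewrite in_itv.
Qed.

(** Monotonicity is not part of the hypothesis. If [eta] vanished only at some [t > 0], the
    intermediate value theorem on both sides of [t] would yield one value taken twice. *)
Lemma gauge0 (eta : R -> R) :
  homeomorphism_on [set t : R | 0 <= t] [set t : R | 0 <= t] eta -> eta 0 = 0.
Proof.
move=> [eP ec [g [gP _ eK gK]]].
have e_ge0 t : 0 <= t -> 0 <= eta t by move=> t0; apply: eP; exists t.
have inj s t : 0 <= s -> 0 <= t -> eta s = eta t -> s = t.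
  by move=> s0 t0 st; rewrite -(eK s) ?inE // -(eK t) ?inE // st.
apply: contrapT => /eqP e0; have e00 : 0 < eta 0 by rewrite lt_neqAle eq_sym e0 e_ge0.
pose t := g 0; have t0 : 0 <= t by apply: gP; exists 0 => //=.
have et : eta t = 0 by apply: gK; rewrite inE /=.
have t1 : 0 < eta (t + 1).
  rewrite lt_neqAle e_ge0 ?andbT; last lra.
  by apply/eqP => h; have := inj t (t + 1) t0 ltac:(lra); rewrite et -h => /(_ erefl); lra.
pose v := Num.min (eta 0) (eta (t + 1)) / 2.
have m0 : 0 < Num.min (eta 0) (eta (t + 1)) by rewrite lt_min e00.
have m1 : Num.min (eta 0) (eta (t + 1)) <= eta 0 by rewrite ge_min lexx.
have m2 : Num.min (eta 0) (eta (t + 1)) <= eta (t + 1) by rewrite ge_min lexx orbT.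
have sub a b : 0 <= a -> {within `[a, b], continuous eta}.
  move=> a0; apply: continuous_subspaceW ec => s; rewrite /= in_itv /= => /andP[h _].
  exact: le_trans h.
have [|a + av] := IVT (v := v) t0 (sub 0 t (lexx _)).
  by rewrite et (min_idPr (ltW e00)) (max_idPl (ltW e00)) /v; apply/andP; split; lra.
rewrite in_itv /= => /andP[a0 a_t].
have [||b + bv] := @IVT R eta t (t + 1) v _ (sub t (t + 1) t0); first lra.
  by rewrite et (min_idPl (ltW t1)) (max_idPr (ltW t1)) /v; apply/andP; split; lra.
rewrite in_itv /= => /andP[tb _].
have ab := inj a b a0 (le_trans t0 tb); rewrite av bv in ab.
have {}ab := ab erefl; have at_ : a = t by lra.
by move: av; rewrite at_ et /v; lra.
Qed.

Lemma gauge_small (eta : R -> R) (e : R) : 0 < e ->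
  homeomorphism_on [set t : R | 0 <= t] [set t : R | 0 <= t] eta ->
  exists2 s : R, 0 < s & forall t, 0 <= t -> e <= eta t -> s <= t.
Proof.
move=> e0 he; have eta0 := gauge0 he; have [_ ec _] := he.
have [|d d0 Hd] := (within_continuous_epsP _ _).1 ec 0 _ e e0; first by rewrite /=.
exists d => // t t0 et; rewrite leNgt; apply/negP => td.
have := Hd t t0; rewrite sub0r normrN ger0_norm // => /(_ td).
by rewrite eta0 sub0r normrN => h; have := ler_norm (eta t); lra.
Qed.

End Gauge.

Section PairConstruction.
Context {R : realType}.

(* The ratio of the distances to [a] and [b] varies continuously on the connected set
   [G], so a cross ratio [2 ^+ l] splits into [l] cross ratios [2]. *)
Lemma qm_power (E E' : completeNormedModType R) (G : set E) (f : E -> E')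
    (q : nat) (a : E) (b : E) :
  connected G -> ~ G a -> ~ G b ->
  (forall z, G z -> 0 < `|f z - f a| /\ 0 < `|f z - f b|) ->
  (forall u v, G u -> G v -> `|u - a| * `|v - b| <= 2 * (`|u - b| * `|v - a|) ->
    `|f u - f a| * `|f v - f b| <= 2 ^+ q * (`|f u - f b| * `|f v - f a|)) ->
  forall (l : nat) u v, G u -> G v ->
    `|u - a| * `|v - b| <= 2 ^+ l * (`|u - b| * `|v - a|) ->
    `|f u - f a| * `|f v - f b| <= 2 ^+ (q * l.+1) * (`|f u - f b| * `|f v - f a|).
Proof.
move=> Gc nGa nGb fpos base.
have pos c z : ~ G c -> G z -> 0 < `|z - c|.
  by move=> nGc Gz; rewrite normr_gt0 subr_eq0; apply/eqP => zc; apply: nGc; rewrite -zc.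
pose h z := `|z - a| / `|z - b|.
have hE (r : R) u v : G u -> G v ->
    (`|u - a| * `|v - b| <= r * (`|u - b| * `|v - a|)) = (h u <= r * h v).
  move=> Gu Gv; have ub := pos b u nGb Gu; have vb := pos b v nGb Gv.
  rewrite /h ler_pdivrMr // [in RHS]mulrA [in RHS]mulrAC ler_pdivlMr //.
  by rewrite -[in RHS]mulrA (mulrC `|v - a|).
have hc : {within G, continuous h}.
  apply: continuous_in_subspaceT => z /set_mem Gz; apply: cvgM.
    by apply: cvg_norm; apply: cvgB; [exact: cvg_id|exact: cvg_cst].
  apply: cvgV; first by rewrite gt_eqF // pos.
  by apply: cvg_norm; apply: cvgB; [exact: cvg_id|exact: cvg_cst].
elim=> [|l IH] u v Gu Gv huv.
  rewrite muln1; apply: base => //; apply: (le_trans huv).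
  by rewrite expr0 ler_wpM2r ?mulr_ge0 //; lra.
have [hs|hs] := leP (`|u - a| * `|v - b|) (2 ^+ l * (`|u - b| * `|v - a|)).
  apply: (le_trans (IH u v Gu Gv hs)); rewrite ler_wpM2r ?mulr_ge0 //.
  by rewrite ler_weXn2l ?ler1n // leq_mul2l leqnSn orbT.
rewrite !hE // in huv; have hvu : 2 ^+ l * h v < h u by rewrite ltNge -hE // -ltNge.
have hv0 : 0 <= h v by rewrite divr_ge0.
have hvl : h v <= 2 ^+ l * h v by rewrite ler_peMl // exprn_ege1 // ler1n.
have /connected_intervalP hI := connected_continuous_connected Gc hc.
have [z Gz hz] : (h @` G) (2 ^+ l * h v).
  by apply: (hI (h v) (h u)); [exists v|exists u|rewrite hvl ltW].
have uz : `|u - a| * `|z - b| <= 2 * (`|u - b| * `|z - a|).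
  by rewrite hE // hz mulrA -exprS.
have zv : `|z - a| * `|v - b| <= 2 ^+ l * (`|z - b| * `|v - a|) by rewrite hE // hz.
have h1 := base u z Gu Gz uz; have h2 := IH z v Gz Gv zv.
have [z1 z2] := fpos z Gz.
rewrite -(ler_pM2r (mulr_gt0 z2 z1)).
have := ler_pM _ _ h1 h2; rewrite !mulr_ge0 // => /(_ isT isT).
rewrite (mulnS q l.+1) exprD => h3; lra.
Qed.

End PairConstruction.

Section Transfer.
Context {R : realType} {E E' : completeNormedModType R}.
Variables (G : set E) (G' : set E') (f : E -> E').

Lemma make_qm_pair (K q : nat) : open G -> open G' -> bdry G !=set0 -> bdry G' !=set0 ->
  connected G -> (forall x, G x -> G' (f x)) -> (forall a, bdry G a -> bdry G' (f a)) ->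
  (forall a', bdry G' a' -> exists2 a, bdry G a & f a = a') ->
  {within closure G, continuous f} ->
  (forall n x y, G x -> G y -> chain G n x y -> chain G' (K * n.+1) (f x) (f y)) ->
  (forall a b u v, bdry G a -> bdry G b -> G u -> G v ->
    `|u - a| * `|v - b| <= 2 * (`|u - b| * `|v - a|) ->
    `|f u - f a| * `|f v - f b| <= 2 ^+ q * (`|f u - f b| * `|f v - f a|)) ->
  (forall a b u v, bdry G a -> bdry G b -> G u -> G v ->
    `|f u - f a| * `|f v - f b| <= 4 * (`|f u - f b| * `|f v - f a|) ->
    `|u - a| * `|v - b| <= 2 ^+ q * (`|u - b| * `|v - a|)) ->
  qm_pair K q G G' f.
Proof.
move=> Go Go' G0 G0' Gc fin fb fs fc fch base baseV; split => //.
move=> l a b u v Ga Gb; apply: qm_power => //; [by case: Ga|by case: Gb| |].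
  move=> z Gz; rewrite !normr_gt0 !subr_eq0; split; apply/eqP => h.
    by have [_ []] := fb a Ga; rewrite -h; exact: fin.
  by have [_ []] := fb b Gb; rewrite -h; exact: fin.
by move=> u' v' Gu' Gv'; exact: base.
Qed.

(** [qh_dist] is an extended real, so its finiteness has to be extracted from the inequality
    together with the bound. *)
Lemma CQH_lower_bound (M C r : R) x y : 1 <= M ->
  ((M^-1)%:E * (qh_dist G x y - C%:E) <= r%:E)%E -> (qh_dist G x y <= (M * r + C)%:E)%E.
Proof.
move=> M1; case: (qh_dist G x y) => [k||] //=.
- by rewrite -EFinB -EFinM !lee_fin ler_pdivrMl; lra.
- by rewrite addye // gt0_muley ?lte_fin ?invr_gt0 //; lra.
- by rewrite leNye.
Qed.

(** A chain of [n] links costs at most [(n + 1) / 3], and the image has to cost less than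
    [K * (n + 1) / 6]; this is the origin of [2 * M + 6 * C < K]. *)
Lemma CQH_chain (M C : R) (K n : nat) x y : 1 <= M -> 0 <= C ->
  2 * M + 6 * C < K%:R -> open G -> open G' -> bdry G !=set0 -> bdry G' !=set0 ->
  CQH M C G G' f -> G x -> G y ->
  (chain G n x y -> chain G' (K * n.+1) (f x) (f y)) /\
  (chain G' n (f x) (f y) -> chain G (K * n.+1) x y).
Proof.
move=> M1 C0 KMC Go Go' G0 G0' [[fG _ _] fk] Gx Gy.
have Gfx : G' (f x) by apply: fG; exists x.
have [lo hi] := fk x y Gx Gy.
have n0 : 0 <= n%:R :> R by [].
have bound : M * (n.+1%:R / 3) + C < (K * n.+1)%:R / 6.
  rewrite natrM -natr1; have h := ltr_pM2r (_ : 0 < n%:R + 1 :> R) (2 * M + 6 * C) K%:R.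
  have := h ltac:(lra); rewrite KMC => h'; have := mulr_ge0 C0 n0; move: h'; lra.
split=> ch.
  have h := qh_dist_chain Go G0 Gx ch; apply: chain_of_qh_dist => //.
  apply: (le_lt_trans hi); apply: (@le_lt_trans _ _ (M * (n.+1%:R / 3) + C)%:E).
    by rewrite EFinD EFinM leeD2r // lee_wpmul2l // lee_fin; lra.
  by rewrite lte_fin.
have h := qh_dist_chain Go' G0' Gfx ch; apply: chain_of_qh_dist => //.
apply: (le_lt_trans (CQH_lower_bound M1 (le_trans lo h))).
by rewrite lte_fin.
Qed.

(** The second implication needs no quasimöbius property of the inverse map. Exchanging [u] and [v]
    inverts the cross ratio: if that of the images is at most 4, its inverse is at least 1/4, so
    [eta] is at least 1/4 at the inverse cross ratio in the source, which is therefore at least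
    [s0]. *)
Lemma qm_base (eta : R -> R) (q : nat) (B s0 : R) :
  {in closure G &, injective f} -> relative_quasimobius eta (closure G) (bdry G) f ->
  (forall t, 0 <= t <= 4 -> eta t <= B) -> B <= 2 ^+ q ->
  0 < s0 -> (forall t, 0 <= t -> 4^-1 <= eta t -> s0 <= t) -> s0^-1 <= 2 ^+ q ->
  forall a b u v, bdry G a -> bdry G b -> G u -> G v ->
  (`|u - a| * `|v - b| <= 4 * (`|u - b| * `|v - a|) ->
    `|f u - f a| * `|f v - f b| <= 2 ^+ q * (`|f u - f b| * `|f v - f a|)) /\
  (`|f u - f a| * `|f v - f b| <= 4 * (`|f u - f b| * `|f v - f a|) ->
    `|u - a| * `|v - b| <= 2 ^+ q * (`|u - b| * `|v - a|)).
Proof.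
move=> inj [_ qm] HB Bq s00 Hs sq a b u v Ga Gb Gu Gv.
have q1 : 1 <= 2 ^+ q :> R by rewrite exprn_ege1 // ler1n.
have [<-|ab] := eqVneq a b.
  by split=> _; rewrite ler_peMl // mulr_ge0.
have [<-|uv] := eqVneq u v.
  by split=> _; rewrite mulrC ler_peMl // mulr_ge0.
have cl z : G z -> closure G z by exact: subset_closure.
have clb z : bdry G z -> closure G z by case.
have neq z c : G z -> bdry G c -> z != c.
  by move=> Gz [_ nGc]; apply/eqP => zc; apply: nGc; rewrite -zc.
have pos z c : G z -> bdry G c -> 0 < `|z - c|.
  by move=> Gz Gb'; rewrite normr_gt0 subr_eq0 neq.
have fpos z c : G z -> bdry G c -> 0 < `|f z - f c|.
  move=> Gz Gc; rewrite normr_gt0 subr_eq0; apply/eqP => /inj; rewrite !inE.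
  by move=> /(_ (cl _ Gz) (clb _ Gc)); apply/eqP/neq.
have key z w : G z -> G w -> z != w ->
    `|f z - f a| / `|f z - f b| * (`|f w - f b| / `|f w - f a|) <=
    eta (`|z - a| / `|z - b| * (`|w - b| / `|w - a|)).
  move=> Gz Gw zw; have := qm z b a w (cl _ Gz) (clb _ Gb) (clb _ Ga) (cl _ Gw).
  rewrite /cross_ratio (distrC (f b)) (distrC (f a)) (distrC b) (distrC a); apply.
    rewrite /= !inE !negb_or (neq z b) // (neq z a) // zw (eq_sym b a) ab.
    by rewrite (eq_sym b w) (neq w b) // (eq_sym a w) (neq w a).
  by right.
have ratio (V W : R) (p1 p2 p3 p4 : R) : 0 < p2 -> 0 < p4 ->
    (p1 / p2 * (p3 / p4) <= V) = (p1 * p3 <= V * (p2 * p4)).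
  by move=> p20 p40; rewrite mulf_div ler_pdivrMr // mulr_gt0.
have [[[ua ub] va] vb] := (pos u a Gu Ga, pos u b Gu Gb, pos v a Gv Ga, pos v b Gv Gb).
have [[[fua fub] fva] fvb] := (fpos u a Gu Ga, fpos u b Gu Gb, fpos v a Gv Ga, fpos v b Gv Gb).
split=> h.
  rewrite -ratio //; apply: (le_trans (key u v Gu Gv uv)); apply: le_trans Bq; apply: HB.
  by rewrite ratio // h andbT mulr_ge0 // divr_ge0.
have t0 : 0 <= `|v - a| / `|v - b| * (`|u - b| / `|u - a|) by rewrite mulr_ge0 // divr_ge0.
have := Hs _ t0.
have vu : v != u by rewrite eq_sym.
move=> /(_ (le_trans _ (key v u Gv Gu vu))) h2.
have {h2} : s0 <= `|v - a| / `|v - b| * (`|u - b| / `|u - a|).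
  apply: h2; rewrite mulf_div ler_pdivlMr ?mulr_gt0 // mulrC.
  by rewrite ler_pdivrMr //; lra.
rewrite mulf_div ler_pdivlMr ?mulr_gt0 // => h3.
have : s0^-1 * (`|u - b| * `|v - a|) <= 2 ^+ q * (`|u - b| * `|v - a|).
  by rewrite ler_wpM2r // mulr_ge0.
apply: le_trans; rewrite ler_pdivlMl //; lra.
Qed.

End Transfer.

Section Assembly.
Context {R : realType}.

Lemma bdry_neq0 (E : completeNormedModType R) (G : set E) :
  domain G -> G `<` setT -> bdry G !=set0.
Proof.
move=> [[x Gx] _ Go] [_ GT].
have [z nGz] : exists z, ~ G z.
  by apply: contrapT => /forallNP H; apply: GT => z _; apply: contrapT; exact: H.
by have [t [_ bt _]] := segment_exit Go Gx nGz; eexists; exact: bt.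
Qed.

Lemma log_chain_le (K K' : nat) (E : completeNormedModType R) (G : set E) :
  (K <= K')%N -> log_chain K G -> log_chain K' G.
Proof.
move=> KK' H x y L Gx Gy xyx xyy; apply: chain_le (H x y L Gx Gy xyx xyy).
by rewrite leq_mul2r KK' orbT.
Qed.

(** [rel_distortion] bounds the relative size of the image by [T'], which depends only on [K], [q]
    and [T]; so [N0] is fixed by [M], [C] and the one value [psi T']. *)
Lemma natural_tame_chain (M C : R) (psi : R -> R) (K q : nat) (T : R) :
  1 <= M -> increasing_gauge psi ->
  exists N0 : nat, forall (E E' : completeNormedModType R) (G : set E) (G' : set E') (f : E -> E'),
    qm_pair K q G G' f -> dim_ge2 E ->
    (exists a b, [/\ bdry G' a, bdry G' b & a != b]) ->
    CQH M C G G' f -> natural_domain psi G' -> tame_chain T N0 G.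
Proof.
move=> M1 [psi0 psi_le]; have [L hL] := le_exp2n T.
set T' : R := 2 ^+ ((9 + 3 * q + 6 * (K * (8 * q + 41) + 4) + 369 * K) * L.+1).
have [N0 hN0] : exists N0 : nat, M * psi T' + C < N0%:R / 6.
  exists (Num.bound (6 * `|M * psi T' + C|)).
  have := archi_boundP (_ : 0 <= 6 * `|M * psi T' + C|).
  by rewrite mulr_ge0 // => /(_ isT); have := ler_norm (M * psi T' + C); lra.
exists N0 => E E' G G' f fp dim2 two cqh nat A Ac AG AT.
have Go := qp_open fp; have Go' := qp_open' fp.
have G0 := qp_bdry0 fp; have G0' := qp_bdry0' fp.
have AL x y : A x -> A y -> `|x - y| <= 2 ^+ L * dist_bdry G x.
  by move=> Ax Ay; apply: (le_trans (AT x y Ax Ay)); rewrite ler_wpM2r // dist_bdry_ge0.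
have D x y : A x -> A y -> `|f x - f y| <= T' * dist_bdry G' (f x).
  move=> Ax Ay; apply: (rel_distortion fp dim2 two (AG _ Ax) (AG _ Ay)); first exact: AL.
  by rewrite distrC; exact: AL.
move=> x y Ax Ay; pose fA := f @` A.
have fAc : connected fA.
  apply: connected_continuous_connected Ac _; apply: continuous_subspaceW (qp_cont fp).
  by move=> z /AG; exact: subset_closure.
have fAG : fA `<=` G' by move=> _ [z Az <-]; apply: (qp_in fp); exact: AG.
have relT : (rel_size G' fA <= T'%:E)%E.
  apply: ub_ereal_sup => _ [_ [_ [[u Au <-] [v Av <-] ->]]]; rewrite lee_fin /rel_dist.
  have du := dist_bdry_gt0 Go' G0' (qp_in fp (AG _ Au)).
  have dv := dist_bdry_gt0 Go' G0' (qp_in fp (AG _ Av)).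
  rewrite ler_pdivrMr; last by rewrite lt_min du.
  by rewrite minEle; case: ifP => _; [exact: D|rewrite distrC; exact: D].
have rel0 : (0 <= rel_size G' fA)%E.
  apply: (@le_trans _ _ (rel_dist G' (f x) (f x))%:E).
    by rewrite lee_fin /rel_dist subrr normr0 mul0r.
  by apply: ereal_sup_ubound; exists (f x), (f x); split => //; exists x.
have relfin : rel_size G' fA \is a fin_num.
  by rewrite ge0_fin_numE //; apply: le_lt_trans relT _; rewrite ltry.
have kT : (qh_dist G' (f x) (f y) <= (psi T')%:E)%E.
  have := nat fA _ fAc fAG; rewrite -ge0_fin_numE // => /(_ _ relfin) h.
  apply: (@le_trans _ _ (qh_size G' fA)).
    by apply: ereal_sup_ubound; exists (f x), (f y); split => //; [exists x|exists y].
  apply: (le_trans (h _)); first by exists (f x); exists x.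
  by rewrite lee_fin; apply: psi_le; rewrite ?fine_ge0 // -lee_fin fineK.
apply: chain_of_qh_dist => //; apply: (@le_lt_trans _ _ (M * psi T' + C)%:E); last by rewrite lte_fin.
apply: CQH_lower_bound => //; apply: le_trans kT.
by case: cqh => _ /(_ x y (AG _ Ax) (AG _ Ay))[].
Qed.

Lemma single_bdry_log_chain (E : completeNormedModType R) (G : set E) (a : E) :
  dim_ge2 E -> open G -> bdry G a -> (forall b, bdry G b -> b = a) -> log_chain 368 G.
Proof.
move=> dim2 Go Ga one x y L Gx Gy xyx xyy.
apply: (@exterior_log_chain R E G a x y 0) => //.
- by move=> b /one ->; rewrite subrr normr0.
- by rewrite mulr0 dist_bdry_ge0.
- by rewrite mulr0 dist_bdry_ge0.
Qed.

End Assembly.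

Theorem corollary1p3 (R : realType) (c M C : R) (eta psi : R -> R)
    (hc : 1 <= c) (hM : 1 <= M) (hC : 0 <= C)
    (heta : homeomorphism_on [set t : R | 0 <= t] [set t : R | 0 <= t] eta)
    (hpsi : increasing_gauge psi) :
  exists2 c1 : R, 1 <= c1 &
    forall (E E' : completeNormedModType R) (G : set E) (G' : set E')
           (f : E -> E'),
      dim_ge2 E -> dim_ge2 E' ->
      domain G -> G `<` setT -> domain G' -> G' `<` setT ->
      CQH M C G G' f ->
      homeomorphism_on (closure G) (closure G') f ->
      relative_quasimobius eta (closure G) (bdry G) f ->
      diameter_uniform_domain c G ->
      natural_domain psi G' ->
      uniform_domain c1 G /\ uniform_domain c1 G'.
Proof.
have [B HB] := gauge_bound (ler0n R 4) heta.
have quarter : 0 < 4^-1 :> R by rewrite invr_gt0.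
have [s0 s00 Hs] := gauge_small quarter heta.
have [q1 hq1] := le_exp2n B; have [q2 hq2] := le_exp2n s0^-1.
set q := (q1 + q2)%N.
have Bq : B <= 2 ^+ q by apply: (le_trans hq1); rewrite ler_weXn2l ?ler1n // leq_addr.
have sq : s0^-1 <= 2 ^+ q by apply: (le_trans hq2); rewrite ler_weXn2l ?ler1n // leq_addl.
have [K hK] : exists K : nat, 2 * M + 6 * C < K%:R.
  exists (Num.bound (2 * M + 6 * C)).
  by have := archi_boundP (_ : 0 <= 2 * M + 6 * C); apply; lra.
have [N0 HN0] := natural_tame_chain C K q (2 * c) hM hpsi.
have [KG HKG] := diameter_uniform_log_chain N0 hc.
set K3 := (9 + 3 * q + 6 * (K * (8 * q + 41) + 4) + 369 * K)%N.
set KG' := (K * (KG * K3.+1).+1)%N.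
(* The sum covers all cases: [KG] for [G] and [KG'] for [G'] when there are two boundary points, 368
   for both domains when there is one. *)
have [c1 c11 Hc1] := @uniform_of_log_chain R (KG + KG' + 368).
exists c1 => // E E' G G' f dE dE' dG GT dG' GT' cqh hf rqm dun nat.
have G0 := bdry_neq0 dG GT; have G0' := bdry_neq0 dG' GT'.
have [_ Gc Go] := dG; have [_ Gc' Go'] := dG'.
suff [l1 l2] : log_chain (KG + KG' + 368) G /\ log_chain (KG + KG' + 368) G'.
  by split; exact: Hc1.
have [fcl fc [g [gcl gc fgK gfK]]] := hf.
have [[fG _ [g0 [g0G _ _ g0K]]] _] := cqh.
have clG z : G z -> closure G z by exact: subset_closure.
have clG' z : G' z -> closure G' z by exact: subset_closure.
have fgKc z : closure G z -> g (f z) = z by move=> h; apply: fgK; rewrite inE.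
have gfKc z : closure G' z -> f (g z) = z by move=> h; apply: gfK; rewrite inE.
have gfi z : G' z -> f (g z) = z by move=> /clG'; exact: gfKc.
have gfb z : bdry G' z -> f (g z) = z by case=> h _; exact: gfKc.
have fin x : G x -> G' (f x) by move=> Gx; apply: fG; exists x.
(* A priori [g] maps [G'] only into [closure G]. Comparison with the inverse [g0] of the map from
   [G] to [G'] puts the images in [G], and then boundaries correspond to boundaries. *)
have gin x : G' x -> G (g x).
  move=> Gx; have Gz : G (g0 x) by apply: g0G; exists x.
  by rewrite -(g0K x) ?inE // fgKc //; exact: clG.
have fb a : bdry G a -> bdry G' (f a).
  move=> [ca nGa]; split; first by apply: fcl; exists a.
  by move=> /gin; rewrite fgKc.
have gb a : bdry G' a -> bdry G (g a).
  move=> [ca nGa]; split; first by apply: gcl; exists a.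
  by move=> /fin; rewrite gfKc.
have inj : {in closure G &, injective f} by exact: can_in_inj fgK.
have [[a [b [Ga Gb ab]]]|one] := pselect (exists a b, [/\ bdry G a, bdry G b & a != b]); last first.
  have [a Ga] := G0.
  have {}one b : bdry G b -> b = a.
    by move=> Gb; apply: contrapT => ba; apply: one; exists b, a; split => //; apply/eqP.
  split; apply: (@log_chain_le _ 368); rewrite ?leq_addl //.
    exact: (single_bdry_log_chain dE Go Ga).
  apply: (single_bdry_log_chain dE' Go' (fb _ Ga)) => b' Gb'.
  by rewrite -(one _ (gb _ Gb')) gfb.
have ch n x y : G x -> G y ->
    (chain G n x y -> chain G' (K * n.+1) (f x) (f y)) /\
    (chain G' n (f x) (f y) -> chain G (K * n.+1) x y).
  by move=> Gx Gy; apply: CQH_chain hK _ _ _ _ _ _ _.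
have base := qm_base inj rqm HB Bq s00 Hs sq.
have fp : qm_pair K q G G' f.
  apply: make_qm_pair => //.
  - by move=> a' Ga'; exists (g a'); [exact: gb|rewrite gfb].
  - by move=> n x y Gx Gy; apply: (ch n x y Gx Gy).1.
  - move=> a1 b1 u v Ga1 Gb1 Gu Gv h; apply: (base a1 b1 u v Ga1 Gb1 Gu Gv).1.
    by apply: (le_trans h); rewrite ler_wpM2r ?mulr_ge0 // ler_nat.
  - by move=> a1 b1 u v Ga1 Gb1 Gu Gv; exact: (base a1 b1 u v Ga1 Gb1 Gu Gv).2.
have gp : qm_pair K q G' G g.
  apply: make_qm_pair => //.
  - by move=> a' Ga'; exists (f a'); [exact: fb|rewrite fgKc //; case: Ga'].
  - move=> n x y Gx Gy h; apply: (ch n (g x) (g y) (gin _ Gx) (gin _ Gy)).2.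
    by rewrite !gfi.
  - move=> a1 b1 u v Ga1 Gb1 Gu Gv h.
    apply: (base _ _ _ _ (gb _ Ga1) (gb _ Gb1) (gin _ Gu) (gin _ Gv)).2.
    rewrite (gfb a1) // (gfb b1) // (gfi u) // (gfi v) //.
    by apply: (le_trans h); rewrite ler_wpM2r ?mulr_ge0 // ler_nat.
  - move=> a1 b1 u v Ga1 Gb1 Gu Gv h.
    have := (base _ _ _ _ (gb _ Ga1) (gb _ Gb1) (gin _ Gu) (gin _ Gv)).1 h.
    by rewrite (gfb a1) // (gfb b1) // (gfi u) // (gfi v).
have two : exists a b, [/\ bdry G a, bdry G b & a != b] by exists a, b.
have two' : exists a b, [/\ bdry G' a, bdry G' b & a != b].
  exists (f a), (f b); split; [exact: fb|exact: fb|].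
  by apply: contra ab => /eqP /inj h; apply/eqP/h; rewrite inE; [case: Ga|case: Gb].
have logG : log_chain KG G.
  by apply: HKG => //; exact: (HN0 _ _ _ _ _ fp dE two' cqh nat).
split; first by apply: log_chain_le logG; rewrite -addnA leq_addr.
apply: (@log_chain_le _ KG'); first by rewrite addnAC leq_addl.
(* The preimages have relative distance at most [2 ^+ (K3 * L.+1)], so a chain of
   [KG * (K3 * L.+1).+1] links joins them in [G]; mapping it back by [f] costs the factor [K]. *)
move=> x y L Gx Gy xyx xyy.
have h1 := rel_distortion gp dE' two Gx Gy xyx xyy.
have h2 : `|g x - g y| <= 2 ^+ (K3 * L.+1) * dist_bdry G (g y).
  by rewrite distrC; apply: (rel_distortion gp dE' two Gy Gx); rewrite distrC.
have := (ch _ _ _ (gin _ Gx) (gin _ Gy)).1 (logG _ _ _ (gin _ Gx) (gin _ Gy) h1 h2).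
rewrite !gfi //.
apply: chain_le; rewrite /KG' -/K3; move: (K3) => k3; clear; nia.
Qed.
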